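(* Let $n\ge 1$ be an integer and $0<s<1$. Then for every $x\in\mathbb R^n$ and $t>0$ one has $$G^{(s)}(x,t)=\int_0^\infty f_s(t;\tau)\,G(x,\tau)\,d\tau .$$ As a consequence, for any $u\in\mathscr S(\mathbb R^n)$ one has $$P^{(s)}_t u(x)=\int_0^\infty f_s(t;\tau)\,P_\tau u(x)\,d\tau .$$
   Context: $\mathscr S(\mathbb R^n)$ is the Schwartz space. $G(x,t)=(4\pi t)^{-n/2}e^{-|x|^2/(4t)}$ is the Gauss–Weierstrass kernel and $P_t u(x)=\int_{\mathbb R^n}G(x-y,t)u(y)\,dy$ the heat semigroup. The fractional heat kernel and semigroup are $$G^{(s)}(x,t)=\int_{\mathbb R^n}e^{-2\pi i\langle x,\xi\rangle}e^{-t(2\pi|\xi|)^{2s}}\,d\xi,\qquad P^{(s)}_t u(x)=\int_{\mathbb R^n}G^{(s)}(x-y,t)\,u(y)\,dy .$$ Bochner's subordinator: for $t>0$, $$f_s(t;\tau)=\begin{cases}\dfrac{1}{2\pi i}\displaystyle\int_{\epsilon-i\infty}^{\epsilon+i\infty}e^{z\tau-tz^s}\,dz, & \tau\ge 0,\\[2mm] 0, & \tau<0,\end{cases}$$ where $\epsilon>0$ is fixed (the value does not depend on it) and $z^s$ is the branch, holomorphic in the plane cut along the negative real axis, with $\Re(z^s)>0$ when $\Re z>0$. *)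

(* Defs.v *)
From HB Require Import structures.
From mathcomp Require Import all_boot all_order all_algebra.
From mathcomp Require Import all_classical all_reals all_analysis.
From mathcomp Require Import complex.

Set Implicit Arguments.
Unset Strict Implicit.
Unset Printing Implicit Defensive.

Import Order.TTheory GRing.Theory Num.Theory.
Import numFieldNormedType.Exports.

Local Open Scope classical_set_scope.
Local Open Scope ring_scope.
Local Open Scope complex_scope.

Section complex_functions.
Context {R : realType}.
Implicit Types z : R[i].

Definition cexp z : R[i] :=
  (expR (complex.Re z))%:C * (cos (complex.Im z) +i* sin (complex.Im z)).

(* Principal argument, with values in ]-pi, pi] for z != 0. *)
Definition carg z : R :=
  let theta := acos (complex.Re z / Normc.normc z) in
  if 0 <= complex.Im z then theta else - theta.

Definition clog z : R[i] := ln (Normc.normc z) +i* carg z.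

(* Principal branch of z^s: holomorphic off the negative real axis, with
   |arg (z^s)| < s * pi / 2 when 0 < Re z, so that 0 < Re (z^s) if s < 1. *)
Definition cpow z (s : R) : R[i] := cexp (s%:C * clog z).

End complex_functions.

Section complex_integral.
Context d (T : measurableType d) (R : realType).
Variable mu : {measure set T -> \bar R}.

Definition cintegrable (D : set T) (f : T -> R[i]) : Prop :=
  mu.-integrable D (fun x => (complex.Re (f x))%:E) /\
  mu.-integrable D (fun x => (complex.Im (f x))%:E).

Definition cintegral (D : set T) (f : T -> R[i]) : R[i] :=
  (\int[mu]_(x in D) complex.Re (f x)) +i* (\int[mu]_(x in D) complex.Im (f x)).

End complex_integral.

(* Lebesgue measure on R^n, as the n-fold product of the Lebesgue measure on
   the line: (x_1, (x_2, .., x_n)) is sent to (x_1, x_2, .., x_n). *)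
Section cons_measure.
Context (R : realType) (n : nat).
Local Notation TR := (measurableTypeR R).
Variable m : {sigma_finite_measure set (n.-tuple TR) -> \bar R}.

Definition cons_pair (p : TR * n.-tuple TR) : n.+1.-tuple TR :=
  [tuple of p.1 :: p.2].

Let measurable_cons_pair : measurable_fun setT cons_pair.
Proof. exact: measurable_cons. Qed.

Let uncons (v : n.+1.-tuple TR) : TR * n.-tuple TR :=
  (thead v, [tuple of behead v]).

Let measurable_uncons : measurable_fun setT uncons.
Proof.
apply: measurable_fun_pair; first exact: measurable_tnth.
exact: measurable_behead.
Qed.

Let cons_pairK : cancel cons_pair uncons.
Proof.
by case=> x v; rewrite /uncons /cons_pair/=; congr pair; exact/val_inj.
Qed.

Definition cons_measure : set (n.+1.-tuple TR) -> \bar R :=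
  pushforward (lebesgue_measure \x m)%E cons_pair.

Let cons_measure0 : cons_measure set0 = 0%E.
Proof. by rewrite /cons_measure /pushforward preimage_set0 measure0. Qed.

Let cons_measure_ge0 A : (0 <= cons_measure A)%E.
Proof. exact: measure_ge0. Qed.

Let cons_measure_sigma_additive : semi_sigma_additive cons_measure.
Proof.
have mpre A : measurable A -> measurable (cons_pair @^-1` A).
  by move=> mA; rewrite -[X in measurable X]setTI; exact: measurable_cons_pair.
move=> F mF tF mUF; rewrite /cons_measure /pushforward preimage_bigcup.
apply: measure_semi_sigma_additive.
- by move=> i; exact: mpre.
- apply/trivIsetP => /= i j _ _ ij; rewrite -preimage_setI.
  by move/trivIsetP : tF => /(_ _ _ _ _ ij) ->//; rewrite preimage_set0.
- by rewrite -preimage_bigcup; exact: mpre.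
Qed.

HB.instance Definition _ := isMeasure.Build _ _ _ cons_measure
  cons_measure0 cons_measure_ge0 cons_measure_sigma_additive.

Let cons_measure_sigma_finite : sigma_finite setT cons_measure.
Proof.
pose l : {sigma_finite_measure set TR -> \bar R} := lebesgue_measure.
have /sigma_finiteP[F [TF ndF Foo]] := sigma_finiteT l.
have /sigma_finiteP[G [TG ndG Goo]] := sigma_finiteT m.
exists (fun k => uncons @^-1` (F k `*` G k)).
  rewrite -preimage_bigcup (_ : \bigcup_k _ = setT) ?preimage_setT//.
  rewrite -subTset => -[x v] _.
  have : setT x by []. rewrite TF => -[i _ Fx].
  have : setT v by []. rewrite TG => -[j _ Gv].
  exists (maxn i j) => //; split => /=.
  - by move: x Fx; exact/subsetPset/ndF/leq_maxl.
  - by move: v Gv; exact/subsetPset/ndG/leq_maxr.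
move=> k; have [mF Fk] := Foo k; have [mG Gk] := Goo k.
have mFG : measurable (F k `*` G k) by exact: measurableX.
split; first by rewrite -[X in measurable X]setTI; exact: measurable_uncons.
rewrite /cons_measure /pushforward -comp_preimage.
rewrite (_ : uncons \o cons_pair = id); last exact/funext/cons_pairK.
by rewrite preimage_id product_measure1E// lte_mul_pinfty// ge0_fin_numE.
Qed.

HB.instance Definition _ := Measure_isSigmaFinite.Build _ _ _ cons_measure
  cons_measure_sigma_finite.

End cons_measure.

Fixpoint lebesgue_Rn (R : realType) (n : nat) :
    {sigma_finite_measure set (n.-tuple (measurableTypeR R)) -> \bar R} :=
  match n with
  | 0 => dirac [tuple]
  | n'.+1 => cons_measure (lebesgue_Rn R n')
  end.

Section heat_kernels.
Context {R : realType} {n : nat}.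
Implicit Types (x y xi : 'rV[R]_n) (u : 'rV[R]_n -> R[i]).

Definition dotrv x y : R := \sum_i x 0 i * y 0 i.

(* The norm `|x| of the library on 'rV[R]_n is the maximum norm. *)
Definition enorm x : R := Num.sqrt (dotrv x x).

Definition integral_Rn (f : 'rV[R]_n -> R[i]) : R[i] :=
  cintegral (lebesgue_Rn R n) setT (fun v => f (\row_i tnth v i)).

Definition heat_kernel x (t : R) : R :=
  (4 * pi * t) `^ (- (n%:R / 2)) * expR (- (enorm x ^+ 2 / (4 * t))).

Definition heat_semigroup (t : R) u x : R[i] :=
  integral_Rn (fun y => (heat_kernel (x - y) t)%:C * u y).

Definition frac_heat_kernel (s : R) x (t : R) : R[i] :=
  integral_Rn (fun xi =>
    cexp (- (2 * pi)%:C * 'i * (dotrv x xi)%:C) *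
    (expR (- t * (2 * pi * enorm xi) `^ (2 * s)))%:C).

Definition frac_heat_semigroup (s t : R) u x : R[i] :=
  integral_Rn (fun y => frac_heat_kernel s (x - y) t * u y).

End heat_kernels.

(* Integral of g over the line Re z = eps, oriented upwards: z = eps + i y and
   dz = i dy. *)
Definition vline_integral (R : realType) (eps : R) (g : R[i] -> R[i]) : R[i] :=
  cintegral lebesgue_measure setT
    (fun y : measurableTypeR R => g (eps +i* y) * 'i).

Definition bochner_subordinator (R : realType) (eps s t tau : R) : R[i] :=
  if 0 <= tau then
    ((2 * pi)%:C * 'i)^-1 *
    vline_integral eps (fun z => cexp (z * tau%:C - t%:C * cpow z s))
  else 0.

Section schwartz.
Context {R : realType} {n : nat}.
Implicit Types (u : 'rV[R]_n -> R[i]) (w : seq 'I_n).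

Definition basis_vec (i : 'I_n) : 'rV[R]_n := delta_mx 0 i.

Definition cpartial (i : 'I_n) u : 'rV[R]_n -> R[i] := fun x =>
  ('D_(basis_vec i) (fun y => complex.Re (u y)) x) +i*
  ('D_(basis_vec i) (fun y => complex.Im (u y)) x).

(* Iterated partial derivatives are indexed by words in the coordinates; on
   smooth functions, words with the same letter counts alpha give the same
   derivative, of multi-index alpha and order |alpha| = size w. *)
Definition cpartials w u : 'rV[R]_n -> R[i] := foldr cpartial u w.

Definition csmooth u : Prop := forall w,
  [/\ continuous (fun x => complex.Re (cpartials w u x)),
      continuous (fun x => complex.Im (cpartials w u x)) &
      forall (i : 'I_n) (x : 'rV[R]_n),
        derivable (fun y => complex.Re (cpartials w u y)) x (basis_vec i) /\
        derivable (fun y => complex.Im (cpartials w u y)) x (basis_vec i)].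

Definition schwartz u : Prop :=
  csmooth u /\
  forall p : nat, exists M : R, forall w (x : 'rV[R]_n), (size w <= p)%N ->
    (1 + enorm x ^+ 2) `^ (p%:R / 2) * Normc.normc (cpartials w u x) <= M.

End schwartz.

(* Main.v *)
(* For a > 0 the subordinator is (2 pi)^-1 times the integral over y of
   exp(z tau - t z^s), z = a + i y, and the choice of a is free by Cauchy's
   theorem on a strip.  The line a = 1/tau, after an integration by parts,
   gives |f_s(t; tau)| <= (C / tau) exp(1 - c tau^-s), which is what makes both
   integrals over tau converge absolutely (at infinity because n >= 1); letting
   a grow shows that the contour integral vanishes for tau < 0.

   The Laplace transform of f_s(t; .) at lambda > 0 is then computed without
   residues: inserting the factor exp(-delta tau^2), choosing the line
   a = lambda and integrating in tau first produces the average of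
   exp(-t (lambda + i y)^s) against a Gaussian in y of variance 2 delta, which
   tends to exp(-t lambda^s) with delta.  With lambda = (2 pi |xi|)^2 and
   G(x, tau) written as the Fourier transform of exp(-tau (2 pi |xi|)^2), both
   claims are applications of Fubini's theorem. *)
Require Import Defs.
From mathcomp Require Import all_boot all_order all_algebra.
From mathcomp Require Import all_classical all_reals all_analysis.
From mathcomp Require Import measurable_realfun complex ring lra.

Import Order.TTheory GRing.Theory Num.Theory.
Import numFieldNormedType.Exports.

Local Open Scope classical_set_scope.
Local Open Scope ring_scope.
Local Open Scope complex_scope.

Set Implicit Arguments.
Unset Strict Implicit.
Unset Printing Implicit Defensive.

Local Notation Re := complex.Re.
Local Notation Im := complex.Im.
Local Notation normc := Normc.normc.

(** * Holomorphy via the Cauchy-Riemann equations *)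

Section complex_components.
Variable R : realType.
Implicit Types (z w : R[i]) (x y : R).

(** All decay comes from one inequality: on the right half-plane |arg z| < pi / 2, so Re z^s >= cos
    (s pi / 2) |z|^s with a positive constant, and exp (- t z^s) dies along vertical lines faster
    than any power.

    Cauchy's theorem needs no contour. If h is holomorphic on a strip, and h and h' are O(1 / (1 +
    y^2)) there, the derivative in x of the integral of h(x + i y) over y is the integral of h' = -
    i dh/dy, a total derivative in y, hence 0. Holomorphy enters only as the Cauchy-Riemann
    equations for the real and imaginary parts.

    The Gaussian factor answers an obstacle. On the line a = lambda, exp (- lambda tau) cancels the
    growth of exp (z tau) and leaves the pure phase exp (i y tau), which is not absolutely
    integrable in tau; without damping the order of integration cannot be exchanged.

    The Laplace formula is available for lambda > 0 only. The frequency xi = 0 must therefore be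
    negligible, a second use of n >= 1. *)

Lemma complexP z w : Re z = Re w -> Im z = Im w -> z = w.
Proof. by case: z w => [a b] [c d] /= -> ->. Qed.

Lemma cReM z w : Re (z * w) = Re z * Re w - Im z * Im w.
Proof. by case: z w => [a b] [c d]. Qed.

Lemma cImM z w : Im (z * w) = Re z * Im w + Im z * Re w.
Proof. by case: z w => [a b] [c d]. Qed.

Lemma cReD z w : Re (z + w) = Re z + Re w.
Proof. by case: z w => [a b] [c d]. Qed.

Lemma cImD z w : Im (z + w) = Im z + Im w.
Proof. by case: z w => [a b] [c d]. Qed.

Lemma cReN z : Re (- z) = - Re z. Proof. by case: z. Qed.

Lemma cImN z : Im (- z) = - Im z. Proof. by case: z. Qed.

Lemma normc_sqrtE z : normc z = Num.sqrt (Re z ^+ 2 + Im z ^+ 2).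
Proof. by case: z. Qed.

Lemma normc_ge0 z : 0 <= normc z.
Proof. by rewrite normc_sqrtE sqrtr_ge0. Qed.

Lemma normc_sqr z : normc z ^+ 2 = Re z ^+ 2 + Im z ^+ 2.
Proof. by rewrite normc_sqrtE sqr_sqrtr// addr_ge0// sqr_ge0. Qed.

Lemma normc_Re z : `|Re z| <= normc z.
Proof. by rewrite normc_sqrtE -sqrtr_sqr ler_wsqrtr// lerDl sqr_ge0. Qed.

Lemma normc_Im z : `|Im z| <= normc z.
Proof. by rewrite normc_sqrtE -sqrtr_sqr ler_wsqrtr// lerDr sqr_ge0. Qed.

Lemma normc_le z : normc z <= `|Re z| + `|Im z|.
Proof.
rewrite -(@ler_pXn2r _ 2%N)// ?nnegrE ?normc_ge0 ?addr_ge0//.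
rewrite normc_sqr sqrrD !real_normK ?num_real// addrAC lerDl.
by rewrite mulrn_wge0// mulr_ge0.
Qed.

Lemma normc_real x : normc x%:C = `|x|.
Proof. by rewrite normc_sqrtE /= expr0n addr0 sqrtr_sqr. Qed.

Lemma normc_cexp z : normc (cexp z) = expR (Re z).
Proof.
rewrite /cexp Normc.normcM normc_real ger0_norm ?expR_ge0//.
by rewrite normc_sqrtE /= cos2Dsin2 sqrtr1 mulr1.
Qed.

Lemma cexpD z w : cexp (z + w) = cexp z * cexp w.
Proof.
rewrite /cexp; apply: complexP; rewrite !(cReM, cImM, cReD, cImD)/= expRD ?cosD ?sinD;
  ring.
Qed.

Lemma cexp_real x : cexp x%:C = (expR x)%:C.
Proof. by rewrite /cexp/= cos0 sin0 mulr1. Qed.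

Lemma Re_cexp z : Re (cexp z) = expR (Re z) * cos (Im z).
Proof. by rewrite /cexp cReM/=; ring. Qed.

Lemma Im_cexp z : Im (cexp z) = expR (Re z) * sin (Im z).
Proof. by rewrite /cexp cImM/=; ring. Qed.

End complex_components.

(* The Cauchy-Riemann equations, in the form: d/dx F = D and d/dy F = i D. *)
Definition cderiv (R : realType) (F : R -> R -> R[i]) (x y : R) (D : R[i]) :=
  [/\ is_derive x 1 (fun u => Re (F u y)) (Re D),
      is_derive x 1 (fun u => Im (F u y)) (Im D),
      is_derive y 1 (fun v => Re (F x v)) (- Im D) &
      is_derive y 1 (fun v => Im (F x v)) (Re D)].

Section cderiv_lemmas.
Variable R : realType.
Implicit Types (F G : R -> R -> R[i]) (x y : R) (D E c : R[i]).

Lemma cderiv_id x y : cderiv (fun u v => u +i* v) x y 1.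
Proof. by split => /=; [| | rewrite oppr0 |]; exact: is_derive_eq. Qed.

Lemma cderivD F G x y D E : cderiv F x y D -> cderiv G x y E ->
  cderiv (fun u v => F u v + G u v) x y (D + E).
Proof.
move=> [F1 F2 F3 F4] [G1 G2 G3 G4].
by split; under eq_fun do rewrite ?(cReD, cImD); rewrite !(cReD, cImD) ?opprD;
  exact: is_deriveD.
Qed.

Lemma cderivZ c F x y D : cderiv F x y D ->
  cderiv (fun u v => c * F u v) x y (c * D).
Proof.
move=> [F1 F2 F3 F4].
split; under eq_fun do rewrite ?(cReM, cImM); rewrite !(cReM, cImM);
  by apply: is_derive_eq; rewrite /GRing.scale/=; ring.
Qed.

Lemma cderivM F G x y D E : cderiv F x y D -> cderiv G x y E ->
  cderiv (fun u v => F u v * G u v) x y (D * G x y + F x y * E).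
Proof.
move=> [F1 F2 F3 F4] [G1 G2 G3 G4].
split; under eq_fun do rewrite ?(cReM, cImM); rewrite !(cReM, cImM, cReD, cImD);
  by apply: is_derive_eq; rewrite /GRing.scale/=; ring.
Qed.

Lemma cderiv_exp F x y D : cderiv F x y D ->
  cderiv (fun u v => cexp (F u v)) x y (cexp (F x y) * D).
Proof.
move=> [F1 F2 F3 F4].
split; under eq_fun do rewrite ?(Re_cexp, Im_cexp);
  rewrite !(cReM, cImM) ?(Re_cexp, Im_cexp);
  apply: is_derive_eq; rewrite /GRing.scale/=; ring.
Qed.

Lemma normc_gt0 x y : 0 < x -> 0 < normc (x +i* y).
Proof. by move=> x0; rewrite normc_sqrtE /= sqrtr_gt0 ltr_wpDr ?sqr_ge0 ?exprn_gt0. Qed.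

(** Since cos (atan (y / x)) = x / |z|, the [acos] in [carg] returns |atan (y / x)|, and the test on
    the sign of y restores the sign. This form, unlike the piecewise one, can be differentiated. *)
Lemma carg_atan x y : 0 < x -> carg (x +i* y) = atan (y / x).
Proof.
move=> x0.
have xn w : x / normc (x +i* w) = cos (atan (w / x)).
  rewrite cos_atan; have -> : 1 + (w / x) ^+ 2 = (x ^+ 2 + w ^+ 2) / x ^+ 2.
    by field; rewrite gt_eqF.
  by rewrite normc_sqrtE sqrtrM ?addr_ge0 ?sqr_ge0//= sqrtrV ?sqr_ge0// sqrtr_sqr
    ger0_norm ?ltW// invfM invrK mulrC.
rewrite /carg /= xn; have [y0|y0] := leP 0 y.
  rewrite cosK// in_itv/= (le_trans (ltW (atan_ltpi2 _))) ?andbT.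
    by rewrite -(@atan0 R) le_atan// divr_ge0// ltW.
  by rewrite ler_pdivrMr// ler_pMr ?pi_gt0// ler1n.
rewrite cosKN ?opprK//; apply/andP; split.
  apply: (le_trans _ (ltW (atan_gtNpi2 _))).
  by rewrite lerN2 ler_pdivrMr// ler_pMr ?pi_gt0// ler1n.
rewrite -(@atan0 R) le_atan// ler_pdivrMr// mul0r; exact: ltW.
Qed.

Lemma clogE x y : 0 < x ->
  clog (x +i* y) = (ln (x ^+ 2 + y ^+ 2) / 2) +i* atan (y / x).
Proof.
move=> x0; rewrite /clog carg_atan// normc_sqrtE/=; congr (_ +i* _).
have h : 0 < x ^+ 2 + y ^+ 2 by rewrite ltr_wpDr ?sqr_ge0 ?exprn_gt0.
by rewrite -[in RHS](sqr_sqrtr (ltW h)) lnXn ?sqrtr_gt0// -[ln _ *+ 2]mulr_natr mulfK.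
Qed.

Lemma cderiv_log x y : 0 < x ->
  cderiv (fun u v => clog (u +i* v)) x y (x +i* y)^-1.
Proof.
move=> x0.
have h : 0 < x ^+ 2 + y ^+ 2 by rewrite ltr_wpDr ?sqr_ge0 ?exprn_gt0.
have nx : \forall u \near x, 0 < u by exact: lt_nbhsr.
have x0' : x != 0 by rewrite gt_eqF.
have h0 : x ^+ 2 + y ^+ 2 != 0 by rewrite gt_eqF.
have iv : is_derive x 1 (fun u : R => u^-1) (- x ^- 2 *: 1).
  exact: (@is_deriveV _ id).
have e1 : (1 + (y / x) ^+ 2)^-1 = x ^+ 2 / (x ^+ 2 + y ^+ 2).
  have -> : 1 + (y / x) ^+ 2 = (x ^+ 2 + y ^+ 2) / x ^+ 2 by field.
  by rewrite invf_div.
have HL : is_derive (x ^+ 2 + y ^+ 2) 1 (@ln R) (x ^+ 2 + y ^+ 2)^-1 by exact: is_derive1_ln.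
split.
(* The closed form [clogE] holds only where the abscissa is positive, so the derivatives in u use it
   on a neighbourhood of x. *)
- apply: (@near_eq_is_derive R R R (fun u : R => ln (u ^+ 2 + y ^+ 2) / 2)) => //.
    by near=> u; rewrite clogE//; near: u.
  have D1 : is_derive x 1 (fun u : R => u ^+ 2 + y ^+ 2) (x * 2).
    by apply: is_derive_eq; rewrite /GRing.scale/=; ring.
  have D2 := @is_derive1_comp _ (@ln R) (fun u : R => u ^+ 2 + y ^+ 2) x _ _ HL D1.
  apply: (@is_derive_eq _ _ _ ((fun u : R => ln (u ^+ 2 + y ^+ 2)) * cst 2^-1)).
  by rewrite /GRing.scale/=; field.
- apply: (@near_eq_is_derive R R R (fun u : R => atan (y / u))) => //.
    by near=> u; rewrite clogE//; near: u.
  have D1 : is_derive x 1 (fun u : R => y / u) (- y / x ^+ 2).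
    apply: (@is_derive_eq _ _ _ (y \*: (fun v : R => v^-1))).
    by rewrite /GRing.scale/=; field.
  have D2 := @is_derive1_comp _ (@atan R) (fun u : R => y / u) x _ _ (is_derive1_atan (y / x)) D1.
  apply: is_derive_eq; rewrite e1 /GRing.scale/=; field; by rewrite ?x0' h0.
- apply: (@near_eq_is_derive R R R (fun v : R => ln (x ^+ 2 + v ^+ 2) / 2)) => //.
    by near=> v; rewrite clogE.
  have D1 : is_derive y 1 (fun v : R => x ^+ 2 + v ^+ 2) (y * 2).
    by apply: is_derive_eq; rewrite /GRing.scale/=; ring.
  have D2 := @is_derive1_comp _ (@ln R) (fun v : R => x ^+ 2 + v ^+ 2) y _ _ HL D1.
  apply: (@is_derive_eq _ _ _ ((fun u : R => ln (x ^+ 2 + u ^+ 2)) * cst 2^-1)).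
  by rewrite /GRing.scale/=; field.
- apply: (@near_eq_is_derive R R R (fun v : R => atan (v / x))) => //.
    by near=> v; rewrite clogE.
  have D1 : is_derive y 1 (fun v : R => v / x) (x^-1).
    by apply: is_derive_eq; rewrite /GRing.scale/=; ring.
  have D2 := @is_derive1_comp _ (@atan R) (fun v : R => v / x) y _ _ (is_derive1_atan (y / x)) D1.
  apply: is_derive_eq; rewrite e1 /GRing.scale/=; field; by rewrite ?x0' h0.
Unshelve. all: end_near. Qed.

Lemma cderiv_pow (s : R) x y : 0 < x ->
  cderiv (fun u v => cpow (u +i* v) s) x y
    (cpow (x +i* y) s * (s%:C / (x +i* y))).
Proof. by move=> x0; apply/cderiv_exp/cderivZ/cderiv_log. Qed.

Lemma normc_cpow (s : R) x y : 0 < x ->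
  normc (cpow (x +i* y) s) = normc (x +i* y) `^ s.
Proof.
move=> x0; rewrite /cpow normc_cexp cReM /= mul0r subr0 /powR gt_eqF//.
exact: normc_gt0.
Qed.

(** The argument of z^s is s arg z, at most s pi / 2 in absolute value, and cos is even and
    decreasing on [0, pi]. *)
Lemma Re_cpow_ge (s : R) x y : 0 < x -> 0 < s -> s < 1 ->
  cos (s * (pi / 2)) * normc (x +i* y) `^ s <= Re (cpow (x +i* y) s).
Proof.
move=> x0 s0 s1; rewrite /cpow Re_cexp.
have -> : Re (s%:C * clog (x +i* y)) = s * ln (normc (x +i* y)).
  by rewrite cReM mul0r subr0.
have -> : Im (s%:C * clog (x +i* y)) = s * carg (x +i* y).
  by rewrite cImM mul0r addr0.
rewrite /powR gt_eqF ?normc_gt0// mulrC ler_wpM2l ?expR_ge0//.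
rewrite carg_atan//; set th := atan _.
have [l u] : - (pi / 2) < th /\ th < pi / 2.
  by split; [exact: atan_gtNpi2|exact: atan_ltpi2].
have pi0 := @pi_gt0 R.
have -> : cos (s * th) = cos (s * `|th|).
  by case: (ler0P th) => // _; rewrite mulrN cosN.
have thb : `|th| <= pi / 2 by rewrite ler_norml !ltW.
have s2 : s * (pi / 2) <= pi.
  by rewrite mulrA ler_pdivrMr// mulrC ler_wpM2l ?ltW//; lra.
have ab := ler_wpM2l (ltW s0) thb.
have a0 : 0 <= s * `|th| by rewrite mulr_ge0// ltW.
by rewrite leNgt ltr_cos ?in_itv/= ?a0 ?(le_trans a0 ab) ?(le_trans ab s2)// -leNgt.
Qed.

Lemma cos_gt0 (s : R) : 0 < s -> s < 1 -> 0 < cos (s * (pi / 2)).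
Proof.
move=> s0 s1; have pi0 := @pi_gt0 R; apply: cos_gt0_pihalf; apply/andP; split.
  by rewrite (@lt_trans _ _ 0)// ?oppr_lt0 ?mulr_gt0 ?divr_gt0.
by rewrite gtr_pMl// divr_gt0.
Qed.

End cderiv_lemmas.

(** * Integrals of complex-valued functions *)

Section complex_integral.
Context d (T : measurableType d) (R : realType).
Variable mu : {measure set T -> \bar R}.
Implicit Types (D : set T) (f g : T -> R[i]) (c : R[i]).

Definition cmeasurable D f :=
  measurable_fun D (fun x => Re (f x)) /\ measurable_fun D (fun x => Im (f x)).

Lemma cmeasurable_real D (f : T -> R) : measurable_fun D f ->
  cmeasurable D (fun x => (f x)%:C).
Proof. by move=> mf; split => //=; exact: measurable_cst. Qed.

Lemma cmeasurable_cst D c : cmeasurable D (fun=> c).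
Proof. by split; exact: measurable_cst. Qed.

Lemma cmeasurableM D f g : cmeasurable D f -> cmeasurable D g ->
  cmeasurable D (fun x => f x * g x).
Proof.
move=> [f1 f2] [g1 g2]; split.
- under eq_fun do rewrite cReM.
  by apply: measurable_funB; exact: measurable_funM.
- under eq_fun do rewrite cImM.
  by apply: measurable_funD; exact: measurable_funM.
Qed.

Lemma cmeasurableD D f g : cmeasurable D f -> cmeasurable D g ->
  cmeasurable D (fun x => f x + g x).
Proof.
move=> [f1 f2] [g1 g2]; split.
- by under eq_fun do rewrite cReD; exact: measurable_funD.
- by under eq_fun do rewrite cImD; exact: measurable_funD.
Qed.

Lemma cmeasurable_cexp D f : cmeasurable D f ->
  cmeasurable D (fun x => cexp (f x)).
Proof.
move=> [f1 f2]; split.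
- under eq_fun do rewrite Re_cexp.
  apply: measurable_funM; first exact: measurableT_comp.
  apply: (measurableT_comp _ f2).
  by apply: continuous_measurable_fun; exact: continuous_cos.
- under eq_fun do rewrite Im_cexp.
  apply: measurable_funM; first exact: measurableT_comp.
  apply: (measurableT_comp _ f2).
  by apply: continuous_measurable_fun; exact: continuous_sin.
Qed.

Lemma measurable_normc D f : cmeasurable D f ->
  measurable_fun D (fun x => normc (f x)).
Proof.
move=> [f1 f2]; under eq_fun do rewrite normc_sqrtE.
have ms : measurable_fun setT (@Num.sqrt R).
  by apply: continuous_measurable_fun; exact: sqrt_continuous.
apply: (measurableT_comp ms).
by apply: measurable_funD; exact: measurable_funX.
Qed.

Lemma cintegrable_measurable D f : cintegrable mu D f -> cmeasurable D f.
Proof.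
by case=> /measurable_int/measurable_EFinP f1 /measurable_int/measurable_EFinP.
Qed.

Lemma cintegrable_le D f (g : T -> R) : measurable D -> cmeasurable D f ->
  (forall x, D x -> normc (f x) <= g x) -> mu.-integrable D (EFin \o g) ->
  cintegrable mu D f.
Proof.
move=> mD [f1 f2] fg ig.
have g0 x : D x -> normc (f x) <= `|g x|.
  by move=> Dx; rewrite (le_trans (fg x Dx))// ler_norm.
split; apply: (le_integrable mD _ _ ig); try exact/measurable_EFinP.
- by move=> x Dx /=; rewrite lee_fin (le_trans (normc_Re _))// g0.
- by move=> x Dx /=; rewrite lee_fin (le_trans (normc_Im _))// g0.
Qed.

Lemma cintegrable_norm D f : measurable D -> cintegrable mu D f ->
  mu.-integrable D (fun x => (normc (f x))%:E).
Proof.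
move=> mD fi; have mf := cintegrable_measurable fi; case: fi => f1 f2.
apply: (@le_integrable _ _ _ mu D mD _
  (fun x => `|(Re (f x))%:E| + `|(Im (f x))%:E|)%E).
- exact/measurable_EFinP/measurable_normc.
- move=> x Dx /=; rewrite lee_fin ger0_norm ?normc_ge0//.
  by rewrite ger0_norm ?addr_ge0// normc_le.
- by apply: integrableD => //; apply: integrable_abse.
Qed.

Lemma cintegrableZl D c f : measurable D -> cintegrable mu D f ->
  cintegrable mu D (fun x => c * f x).
Proof.
move=> mD fi; apply: (@cintegrable_le _ _ (fun x => normc c * normc (f x))) => //.
- by apply: cmeasurableM; [exact: cmeasurable_cst|exact: cintegrable_measurable].
- by move=> x _; rewrite Normc.normcM.
- exact: (integrableZl mD _ (cintegrable_norm mD fi)).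
Qed.

Lemma cintegralZl D c f : measurable D -> cintegrable mu D f ->
  cintegral mu D (fun x => c * f x) = c * cintegral mu D f.
Proof.
move=> mD [f1 f2]; apply: complexP; rewrite ?cReM ?cImM/=.
- rewrite -!RintegralZl// -RintegralB//.
  + by apply: eq_Rintegral => x _; rewrite cReM.
  + exact: (integrableZl mD _ f1).
  + exact: (integrableZl mD _ f2).
- rewrite -!RintegralZl// -RintegralD//.
  + by apply: eq_Rintegral => x _; rewrite cImM.
  + exact: (integrableZl mD _ f2).
  + exact: (integrableZl mD _ f1).
Qed.

Lemma cintegrableD D f g : measurable D -> cintegrable mu D f ->
  cintegrable mu D g -> cintegrable mu D (fun x => f x + g x).
Proof.
move=> mD [f1 f2] [g1 g2]; split.
- by under eq_fun do rewrite cReD EFinD; exact: integrableD.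
- by under eq_fun do rewrite cImD EFinD; exact: integrableD.
Qed.

Lemma cintegralD D f g : measurable D -> cintegrable mu D f ->
  cintegrable mu D g ->
  cintegral mu D (fun x => f x + g x) = cintegral mu D f + cintegral mu D g.
Proof.
move=> mD [f1 f2] [g1 g2]; apply: complexP; rewrite ?cReD ?cImD/= -RintegralD//.
- by apply: eq_Rintegral => x _; rewrite cReD.
- by apply: eq_Rintegral => x _; rewrite cImD.
Qed.

Lemma eq_cintegral D f g : {in D, f =1 g} -> cintegral mu D f = cintegral mu D g.
Proof.
by move=> fg; apply: complexP => /=; apply: eq_Rintegral => x Dx; rewrite fg.
Qed.

Lemma eq_cintegrable D f g : measurable D -> {in D, f =1 g} ->
  cintegrable mu D f -> cintegrable mu D g.
Proof.
by move=> mD fg [f1 f2]; split;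
  [apply: eq_integrable f1|apply: eq_integrable f2] => // x Dx; rewrite fg.
Qed.

(** The factor 2 comes from bounding the real and imaginary parts separately; it only enters
    constants. *)
Lemma normc_cintegral_le D f (g : T -> R) : measurable D -> cintegrable mu D f ->
  (forall x, D x -> normc (f x) <= g x) -> mu.-integrable D (EFin \o g) ->
  normc (cintegral mu D f) <= 2 * (\int[mu]_(x in D) g x).
Proof.
move=> mD [f1 f2] fg ig; rewrite (le_trans (normc_le _))//= mulrDl !mul1r.
apply: lerD; rewrite (le_trans (le_normr_Rintegral mD _))//;
  apply: le_Rintegral => //; try exact: integrable_norm.
- by move=> x Dx; rewrite (le_trans (normc_Re _))// fg.
- by move=> x Dx; rewrite (le_trans (normc_Im _))// fg.
Qed.

Lemma cintegral_mkcond D f : (forall x, ~ D x -> f x = 0) ->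
  cintegral mu D f = cintegral mu setT f.
Proof.
move=> f0; apply: complexP; rewrite /cintegral/= Rintegral_mkcond;
  apply: eq_Rintegral => x _; rewrite patchE; case: ifPn => //;
  by rewrite notin_setE => /f0 ->.
Qed.

Lemma cintegrable_mkcond D f : measurable D -> (forall x, ~ D x -> f x = 0) ->
  cintegrable mu D f <-> cintegrable mu setT f.
Proof.
move=> mD f0.
have h (p : R[i] -> R) : p 0 = 0 ->
    (fun x => (p (f x))%:E) \_ D = (fun x => (p (f x))%:E).
  move=> p0; apply/funext => x; rewrite patchE; case: ifPn => //.
  by rewrite notin_setE => /f0 ->; rewrite p0.
rewrite /cintegrable; split => -[f1 f2]; split.
- by rewrite -(h (@complex.Re R))//; exact/(integrable_mkcond _ mD).1.
- by rewrite -(h (@complex.Im R))//; exact/(integrable_mkcond _ mD).1.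
- by apply/(integrable_mkcond _ mD).2; rewrite h.
- by apply/(integrable_mkcond _ mD).2; rewrite h.
Qed.

Lemma ae_eq_cintegral D f g : measurable D -> cmeasurable D f -> cmeasurable D g ->
  {ae mu, forall x, D x -> f x = g x} -> cintegral mu D f = cintegral mu D g.
Proof.
move=> mD [f1 f2] [g1 g2] fg; apply: complexP => /=; congr fine;
  apply: ae_eq_integral => //; try exact/measurable_EFinP.
- by apply: filterS fg => x fg Dx /=; rewrite fg.
- by apply: filterS fg => x fg Dx /=; rewrite fg.
Qed.

End complex_integral.

(** * Fubini's theorem for real and complex integrands *)

Section complex_fubini.
Context d1 d2 (T1 : measurableType d1) (T2 : measurableType d2) (R : realType).
Variable m1 : {sigma_finite_measure set T1 -> \bar R}.
Variable m2 : {sigma_finite_measure set T2 -> \bar R}.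

(** The inner [Rintegral] is the [fine] part of an extended integral. Almost every section of f is
    integrable, so the two agree almost everywhere and the extended statement transfers. *)
Lemma Rintegral_fubini1 (f : T1 * T2 -> R) :
  (m1 \x m2)%E.-integrable setT (EFin \o f) ->
  m1.-integrable setT (fun x => (\int[m2]_y f (x, y))%:E) /\
  \int[m1]_x \int[m2]_y f (x, y) = \int[(m1 \x m2)%E]_z f z.
Proof.
move=> fi; have Fi := integrable_fubini_F fi.
have ae : {ae m1, forall x, setT x ->
    (\int[m2]_y (f (x, y))%:E = (\int[m2]_y f (x, y))%:E)%E}.
  apply: filterS (ae_integrable1 fi) => x fx _.
  by rewrite /Rintegral fineK// integrable_fin_num.
have mF : measurable_fun setT (fun x => (\int[m2]_y f (x, y))%:E).
  apply/measurable_EFinP; apply: measurableT_comp => //.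
  exact: (measurable_int _ Fi).
split.
  apply/integrableP; split => //.
  rewrite (_ : (\int[m1]_x _ = \int[m1]_x `|\int[m2]_y (f (x, y))%:E|)%E).
    by case/integrableP : Fi.
  apply: ae_eq_integral => //; try by apply: measurableT_comp => //.
    by apply: measurableT_comp => //; exact: (measurable_int _ Fi).
  by apply: filterS ae => x /(_ I) e _ /=; rewrite e.
rewrite /Rintegral -(integral12_prod_meas1 fi); congr fine.
apply: ae_eq_integral => //; first exact: (measurable_int _ Fi).
by apply: filterS ae => x /(_ I) e _ /=; rewrite e.
Qed.

Lemma Rintegral_fubini2 (f : T1 * T2 -> R) :
  (m1 \x m2)%E.-integrable setT (EFin \o f) ->
  m2.-integrable setT (fun y => (\int[m1]_x f (x, y))%:E) /\
  \int[m2]_y \int[m1]_x f (x, y) = \int[(m1 \x m2)%E]_z f z.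
Proof.
move=> fi; have mG := measurable_fubini_G fi.
have ae : {ae m2, forall y, setT y ->
    (\int[m1]_x (f (x, y))%:E = (\int[m1]_x f (x, y))%:E)%E}.
  apply: filterS (ae_integrable2 fi) => x fx _.
  by rewrite /Rintegral fineK// integrable_fin_num.
have mF : measurable_fun setT (fun y => (\int[m1]_x f (x, y))%:E).
  by apply/measurable_EFinP; apply: measurableT_comp.
split.
  apply/integrableP; split => //.
  rewrite (_ : (\int[m2]_x _ = \int[m2]_y `|\int[m1]_x (f (x, y))%:E|)%E).
    have mf := measurable_int _ fi.
    apply: le_lt_trans ((integrable21ltyP m1 m2 mf).1 fi).
    apply: ge0_le_integral => //.
    - exact: measurableT_comp.
    - apply: (measurable_fun_fubini_tonelli_G (abse \o (EFin \o f)))  => //=.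
      exact: measurableT_comp.
    - move=> y _; apply: le_abse_integral => //.
      apply/measurable_EFinP/(measurable_fun_pair1 y).
      exact/measurable_EFinP.
  apply: ae_eq_integral => //; try by apply: measurableT_comp => //.
  by apply: filterS ae => x /(_ I) e _ /=; rewrite e.
rewrite /Rintegral -(integral21_prod_meas1 fi); congr fine.
apply: ae_eq_integral => //.
by apply: filterS ae => x /(_ I) e _ /=; rewrite e.
Qed.

Lemma cfubini1 (F : T1 * T2 -> R[i]) : cintegrable (m1 \x m2)%E setT F ->
  cintegrable m1 setT (fun x => cintegral m2 setT (fun y => F (x, y))) /\
  cintegral m1 setT (fun x => cintegral m2 setT (fun y => F (x, y))) =
  cintegral (m1 \x m2)%E setT F.
Proof.
move=> [/Rintegral_fubini1[f1 e1] /Rintegral_fubini1[f2 e2]]; split => //.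
by apply: complexP.
Qed.

Lemma cfubini2 (F : T1 * T2 -> R[i]) : cintegrable (m1 \x m2)%E setT F ->
  cintegrable m2 setT (fun y => cintegral m1 setT (fun x => F (x, y))) /\
  cintegral m2 setT (fun y => cintegral m1 setT (fun x => F (x, y))) =
  cintegral (m1 \x m2)%E setT F.
Proof.
move=> [/Rintegral_fubini2[f1 e1] /Rintegral_fubini2[f2 e2]]; split => //.
by apply: complexP.
Qed.

Lemma cintegrable_prod (F : T1 * T2 -> R[i]) (g1 : T1 -> R) (g2 : T2 -> R) :
  cmeasurable setT F ->
  (forall x y, normc (F (x, y)) <= g1 x * g2 y) ->
  m1.-integrable setT (EFin \o g1) -> m2.-integrable setT (EFin \o g2) ->
  cintegrable (m1 \x m2)%E setT F.
Proof.
move=> mF Fg i1 i2.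
have h1 : measurable_fun setT g1 by exact/measurable_EFinP/(measurable_int _ i1).
have h2 : measurable_fun setT g2 by exact/measurable_EFinP/(measurable_int _ i2).
apply: (@cintegrable_le _ _ _ _ _ _ (fun z => g1 z.1 * g2 z.2)) => //.
  by move=> -[x y] _; exact: Fg.
have mg : measurable_fun setT (EFin \o (fun z : T1 * T2 => g1 z.1 * g2 z.2)).
  apply/measurable_EFinP; apply: measurable_funM.
  - exact: (measurableT_comp h1 measurable_fst).
  - exact: (measurableT_comp h2 measurable_snd).
apply/(integrable12ltyP m1 m2 mg) => /=.
have [_ l1] := integrableP _ _ _ i1; have [_ l2] := integrableP _ _ _ i2.
under eq_integral => x _.
  under eq_integral do rewrite normrM EFinM.
  rewrite ge0_integralZl//; last exact/measurable_EFinP/measurableT_comp.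
  over.
rewrite ge0_integralZr//; last 2 first.
- exact/measurable_EFinP/measurableT_comp.
- exact: integral_ge0.
by rewrite lte_mul_pinfty// ?integral_ge0// ge0_fin_numE ?integral_ge0.
Qed.

End complex_fubini.

(** * Cauchy's theorem on a strip *)

Section line_integrals.
Variable R : realType.
Implicit Types (x y : R) (K A B : R).

Local Notation mu := (@lebesgue_measure R).
Local Notation lor y := (oneDsqr y)^-1.

Lemma lor_gt0 y : 0 < lor y.
Proof. by rewrite invr_gt0 (lt_le_trans ltr01)// oneDsqr_ge1. Qed.

(** The Lorentzian 1 / (1 + y^2) is the common dominating function: decay on vertical lines is
    always reduced to a multiple of it. *)
Lemma integrable_lor K : mu.-integrable setT (fun y => (K * lor y)%:E).
Proof.
suff h : mu.-integrable setT (fun y => (lor y)%:E) by exact: (integrableZl measurableT K h).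
apply/integrableP; split.
  apply/measurable_EFinP; apply: continuous_measurable_fun.
  exact: continuous_oneDsqrV.
under eq_integral do rewrite gee0_abs ?lee_fin ?ltW ?lor_gt0//.
rewrite (ge0_symfun_integralT (f := fun y => lor y)).
- by rewrite -set_itvcy integral0y_oneDsqr ltry.
- by move=> y; rewrite ltW// lor_gt0.
- exact: continuous_oneDsqrV.
- by move=> y /=; rewrite /oneDsqr sqrrN.
Qed.

Lemma cvg_lor K : K * lor (n%:R : R) @[n --> \oo] --> (0 : R).
Proof.
rewrite -[X in _ --> X](mulr0 K); apply: cvgMr.
apply: (@squeeze_cvgr _ _ _ _ (fun=> 0) (fun n => harmonic n)).
- near=> n; rewrite ltW ?lor_gt0//= /harmonic/= lef_pV2 ?posrE//.
  rewrite /oneDsqr -natr1 addrC lerD2l -natrX ler_nat.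
  by rewrite -[X in (X <= _)%N]expn1 leq_pexp2l//; near: n; exact: nbhs_infty_gt.
- exact: cvg_cst.
- exact: cvg_harmonic.
Unshelve. all: end_near. Qed.

(** On [-k, k] the integral is u k - u (- k), which tends to 0; dominated convergence passes to the
    whole line. *)
Lemma integral_derive_eq0 (u u' : R -> R) K :
  (forall y, is_derive y 1 u (u' y)) -> continuous u' ->
  (forall y, `|u y| <= K * lor y) -> (forall y, `|u' y| <= K * lor y) ->
  (\int[mu]_y u' y = 0)%R.
Proof.
move=> du cu ubd u'bd.
have cont_u : continuous u.
  by move=> y; apply/differentiable_continuous/derivable1_diffP.
pose f_ (k : nat) := (EFin \o u') \_ (`[- k%:R, k%:R]%classic).
have mf k : measurable_fun setT (f_ k).
  apply/(measurable_restrictT _ _).1 => //.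
  by apply/measurable_EFinP; apply: measurable_funTS; exact: continuous_measurable_fun.
have intf_ : (fun k => \int[mu]_x f_ k x)%E = fun k => (u k%:R - u (- k%:R))%:E.
  (* For k = 0 the interval is a point, whereas [continuous_FTC2] asks for distinct end points. *)
  apply/funext => -[|k].
    rewrite /f_ oppr0 subrr.
    by rewrite -integral_mkcond set_itv1 integral_set1.
  rewrite /f_ -integral_mkcond (@continuous_FTC2 _ _ u) ?EFinB//.
  - by rewrite (@lt_trans _ _ 0)// oppr_lt0.
  - exact: continuous_subspaceT.
  - split.
    + by move=> x _; exact: ex_derive.
    + exact/cvg_at_right_filter/cont_u.
    + exact/cvg_at_left_filter/cont_u.
  - by move=> x _; rewrite derive1E derive_val.
have mu' : measurable_fun setT (fun y => (u' y)%:E).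
  by apply/measurable_EFinP; exact: continuous_measurable_fun.
have [||_ _] := @dominated_convergence _ _ _ mu setT measurableT f_
  (fun y => (u' y)%:E) (fun y => (K * lor y)%:E) mf mu' _ (integrable_lor K).
- apply/aeW => y _; apply: cvg_near_cst; near=> k.
  rewrite /f_ patchE mem_set//= in_itv/=.
  have : `|y| <= k%:R by near: k; exact: nbhs_infty_ger.
  by rewrite ler_norml.
- apply/aeW => y k _; rewrite /f_ patchE; case: ifPn => _; rewrite ?abse0 lee_fin//.
  by rewrite (le_trans _ (ubd y)).
rewrite intf_ => cvgI; rewrite /Rintegral.
suff -> : (\int[mu]_y (u' y)%:E = 0)%E by [].
rewrite -(cvg_lim _ cvgI)//; apply/cvg_lim => //.
apply: cvg_EFin; first by apply: nearW.
apply: (@squeeze_cvgr _ _ _ _ (fun k => - (2 * K * lor (k%:R)))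
                              (fun k => 2 * K * lor (k%:R))).
- near=> k; rewrite -ler_norml (le_trans (ler_normB _ _))//.
  by rewrite -mulrA mulrDl mul1r lerD// (le_trans (ubd _))// /oneDsqr sqrrN.
- by rewrite -oppr0; apply: cvgN; exact: cvg_lor.
- exact: cvg_lor.
Unshelve. all: end_near. Qed.


(** The bound on f', uniform in x, allows differentiation under the integral; the derivative is 0
    and the mean value theorem concludes. *)
Lemma integral_param_cst (f f' : R -> R -> R) A B K :
  (forall x y, A < x < B -> is_derive x 1 (f^~ y) (f' x y)) ->
  (forall x, A < x < B -> measurable_fun setT (f x)) ->
  (forall x y, A < x < B -> `|f x y| <= K * lor y) ->
  (forall x y, A < x < B -> `|f' x y| <= K * lor y) ->
  (forall x, A < x < B -> \int[mu]_y f' x y = 0)%R ->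
  forall a b, A < a < B -> A < b < B ->
  (\int[mu]_y f a y = \int[mu]_y f b y)%R.
Proof.
move=> df mf fK f'K f'0.
have K0 y : 0 <= `|K| * lor y by rewrite mulr_ge0// ltW// lor_gt0.
have KK y : K * lor y <= `|K| * lor y.
  by rewrite ler_wpM2r ?ler_norm// ltW// lor_gt0.
have intf x : `]A, B[%classic x -> mu.-integrable setT (EFin \o f x).
  rewrite /= in_itv/= => xAB.
  apply: (le_integrable measurableT _ _ (integrable_lor `|K|)).
    by apply/measurable_EFinP; exact: mf.
  move=> y _ /=; rewrite lee_fin (ger0_norm (K0 y)).
  by rewrite (le_trans (fK _ _ xAB)).
have d1 x y : `]A, B[%classic x -> setT y -> derivable (f^~ y) x 1.
  by rewrite /= in_itv/= => xAB _; have := df x y xAB => dxy; exact: ex_derive.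
have d1E x y : A < x < B -> partial1of2 f x y = f' x y.
  by move=> xAB; rewrite partial1of2E; have := df x y xAB => dxy; exact: derive_val.
have d1K x y : `]A, B[%classic x -> setT y ->
    `|partial1of2 f x y| <= `|K| * lor y.
  by rewrite /= in_itv/= => xAB _; rewrite d1E// (le_trans (f'K _ _ xAB)).
have dF x : A < x < B -> is_derive x 1 (fun x => \int[mu]_y f x y)%R 0.
  move=> xAB; have Ix : `]A, B[%classic x by rewrite /= in_itv.
  apply: DeriveDef.
    exact: (derivable_under_integral measurableT Ix intf d1 K0 (integrable_lor _) d1K).
  rewrite -derive1E.
  rewrite (differentiation_under_integral measurableT Ix intf d1 K0 (integrable_lor _) d1K).
  by rewrite -(f'0 x xAB); apply: eq_Rintegral => y _; exact: d1E.
suff W a b : A < a -> b < B -> a <= b ->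
    (\int[mu]_y f a y = \int[mu]_y f b y)%R.
  move=> a b /andP[a1 a2] /andP[b1 b2].
  by have [ab|/ltW ba] := leP a b; [exact: W|exact/esym/W].
move=> Aa bB ab.
have sub x : x \in `[a, b] -> A < x < B.
  by rewrite in_itv/= => /andP[ax xb]; rewrite (lt_le_trans Aa ax) (le_lt_trans xb bB).
have [||c _] := @MVT_segment _ (fun x => \int[mu]_y f x y)%R (fun=> 0) a b ab.
- by move=> x xab; apply/dF/sub/subset_itv_oo_cc.
- apply: derivable_within_continuous => x xab.
  by have := dF x (sub x xab) => dx; exact: ex_derive.
- by rewrite mul0r => /eqP; rewrite subr_eq0 => /eqP.
Qed.

Definition ccontinuous (f : R -> R[i]) :=
  continuous (fun y => Re (f y)) /\ continuous (fun y => Im (f y)).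

Lemma ccontinuousM f g : ccontinuous f -> ccontinuous g ->
  ccontinuous (fun y => f y * g y).
Proof.
move=> [f1 f2] [g1 g2]; split => y.
- under eq_fun do rewrite cReM.
  by apply: cvgB; apply: cvgM; [exact: f1|exact: g1|exact: f2|exact: g2].
- under eq_fun do rewrite cImM.
  by apply: cvgD; apply: cvgM; [exact: f1|exact: g2|exact: f2|exact: g1].
Qed.

Lemma ccontinuousD f g : ccontinuous f -> ccontinuous g ->
  ccontinuous (fun y => f y + g y).
Proof.
move=> [f1 f2] [g1 g2]; split => y.
- by under eq_fun do rewrite cReD; apply: cvgD; [exact: f1|exact: g1].
- by under eq_fun do rewrite cImD; apply: cvgD; [exact: f2|exact: g2].
Qed.

Lemma ccontinuous_cst c : ccontinuous (fun=> c).
Proof. by split => y; exact: cvg_cst. Qed.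

Lemma cderiv_ccontinuous (h : R -> R -> R[i]) x (h' : R -> R[i]) :
  (forall y, cderiv h x y (h' y)) -> ccontinuous (h x).
Proof.
move=> dh; split => y; apply/differentiable_continuous/derivable1_diffP;
  by have [_ _ d1 d2] := dh y; exact: ex_derive.
Qed.

Lemma ccontinuous_measurable f : ccontinuous f -> cmeasurable (T := measurableTypeR R) setT f.
Proof. by case=> f1 f2; split; exact: continuous_measurable_fun. Qed.

Lemma line_cintegrable f K : ccontinuous f ->
  (forall y, normc (f y) <= K * lor y) -> cintegrable mu setT f.
Proof.
move=> cf fK; apply: cintegrable_le (integrable_lor K) => //.
exact: ccontinuous_measurable.
Qed.

(** By Cauchy-Riemann, Re h' and Im h' are the y-derivatives of Im h and - Re h, so both integrate
    to 0. *)
Lemma cintegral_cderiv_eq0 (h : R -> R -> R[i]) x (h' : R -> R[i]) K :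
  (forall y, cderiv h x y (h' y)) -> ccontinuous h' ->
  (forall y, normc (h x y) <= K * lor y) ->
  (forall y, normc (h' y) <= K * lor y) ->
  cintegral mu setT h' = 0.
Proof.
move=> dh [c1 c2] hK h'K; apply: complexP => /=.
- apply: (@integral_derive_eq0 (fun y => Im (h x y)) _ K) => //.
  + by move=> y; have [] := dh y.
  + by move=> y; rewrite (le_trans (normc_Im _)).
  + by move=> y; rewrite (le_trans (normc_Re _)).
- apply: (@integral_derive_eq0 (fun y => - Re (h x y)) _ K) => //.
  + by move=> y; have [_ _ d _] := dh y; rewrite -[Im _]opprK; exact: is_deriveN.
  + by move=> y; rewrite normrN (le_trans (normc_Re _)).
  + by move=> y; rewrite (le_trans (normc_Im _)).
Qed.

(** Cauchy's theorem on the strip. K must not depend on the abscissa, because it dominates the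
    differentiation in x. *)
Lemma vline_shift (h h' : R -> R -> R[i]) A B K :
  (forall x y, A < x < B -> cderiv h x y (h' x y)) ->
  (forall x, A < x < B -> ccontinuous (h' x)) ->
  (forall x y, A < x < B -> normc (h x y) <= K * lor y) ->
  (forall x y, A < x < B -> normc (h' x y) <= K * lor y) ->
  forall a b, A < a < B -> A < b < B ->
  cintegral mu setT (h a) = cintegral mu setT (h b).
Proof.
move=> dh ch hK h'K a b aAB bAB.
have mh x : A < x < B -> cmeasurable (T := measurableTypeR R) setT (h x).
  by move=> xAB; apply: ccontinuous_measurable; apply: cderiv_ccontinuous => y; exact: dh.
have h0 x (xAB : A < x < B) :=
  cintegral_cderiv_eq0 (fun y => dh x y xAB) (ch x xAB) (fun y => hK x y xAB)
   (fun y => h'K x y xAB).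
apply: complexP => /=.
- apply: (@integral_param_cst (fun x y => Re (h x y)) (fun x y => Re (h' x y)) A B K) => //.
  + by move=> x y xAB; have [] := dh x y xAB.
  + by move=> x xAB; case: (mh x xAB).
  + by move=> x y xAB; rewrite (le_trans (normc_Re _))// hK.
  + by move=> x y xAB; rewrite (le_trans (normc_Re _))// h'K.
  + by move=> x xAB; have /(congr1 (@complex.Re R)) := h0 x xAB.
- apply: (@integral_param_cst (fun x y => Im (h x y)) (fun x y => Im (h' x y)) A B K) => //.
  + by move=> x y xAB; have [] := dh x y xAB.
  + by move=> x xAB; case: (mh x xAB).
  + by move=> x y xAB; rewrite (le_trans (normc_Im _))// hK.
  + by move=> x y xAB; rewrite (le_trans (normc_Im _))// h'K.
  + by move=> x xAB; have /(congr1 (@complex.Im R)) := h0 x xAB.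
Qed.

End line_integrals.

(** * The Fourier transform of a Gaussian *)

Section gaussian.
Variable R : realType.
Implicit Types (x y c d u w : R).

Local Notation mu := (@lebesgue_measure R).
Local Notation lor y := (oneDsqr y)^-1.

Lemma exp_decay c N : 0 < c -> exists K, 0 < K /\
  forall u, 0 <= u -> (1 + u) ^+ N * expR (- (c * u)) <= K.
Proof.
(* The inequality x <= exp x at x = (1 + u) k, raised to the power N, costs exp (N k (1 + u)), and N
   k <= c. The successor keeps the quotient meaningful for N = 0. *)
move=> c0; pose k := c / N.+1%:R; have k0 : 0 < k by rewrite divr_gt0.
exists (k ^- N * expR c); split; first by rewrite mulr_gt0 ?expR_gt0 ?invr_gt0 ?exprn_gt0.
move=> u u0; have u1 : 0 <= 1 + u by rewrite addr_ge0.
have h1 : (1 + u) * k <= expR ((1 + u) * k).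
  by rewrite (le_trans _ (expR_ge1Dx _))// lerDr.
have h2 : ((1 + u) * k) ^+ N <= expR (c * (1 + u)).
  apply: (@le_trans _ _ (expR ((1 + u) * k) ^+ N)).
    by apply: lerXn2r; rewrite ?nnegrE ?expR_ge0// mulr_ge0// ltW.
  rewrite -expRM_natl ler_expR mulrCA mulrC ler_wpM2r//.
  by rewrite /k mulrA ler_pdivrMr// mulrC ler_wpM2l ?(ltW c0)// ler_nat.
rewrite ler_pdivlMl ?exprn_gt0// mulrA -exprMn (mulrC k).
rewrite (le_trans (ler_wpM2r (expR_ge0 _) h2))// -expRD ler_expR.
by rewrite mulrDr mulr1 addrK.
Qed.

Lemma cexp_gauss d x y :
  normc (cexp (d%:C * ((x +i* y) * (x +i* y)))) =
  expR (d * x ^+ 2) * expR (- (d * y ^+ 2)).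
Proof.
rewrite normc_cexp -expRD; congr expR; rewrite !cReM cImM /=; ring.
Qed.

Lemma gauss_integral0 d : 0 < d ->
  \int[mu]_y expR (- (d * y ^+ 2)) = Num.sqrt (pi / d).
Proof.
move=> d0; pose s := Num.sqrt (2 * d)^-1.
have d20 : 0 < (2 * d)^-1 by rewrite invr_gt0 mulr_gt0.
have s0 : s != 0 by rewrite gt_eqF// sqrtr_gt0.
have s2 : s ^+ 2 = (2 * d)^-1 by rewrite sqr_sqrtr// ltW.
have p0 : 0 < Num.sqrt (pi / d) by rewrite sqrtr_gt0 divr_gt0// pi_gt0.
have E y : expR (- (d * y ^+ 2)) = Num.sqrt (pi / d) * normal_pdf 0 s y.
  rewrite normal_pdfE// /normal_peak /normal_fun s2 subr0.
  have -> : (2 * d)^-1 * pi *+ 2 = pi / d.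
    by rewrite -mulr_natr; field; rewrite gt_eqF.
  rewrite mulVKf ?gt_eqF//; congr expR.
  by rewrite -mulr_natr; field; rewrite gt_eqF.
rewrite /Rintegral; under eq_integral do rewrite E EFinM.
rewrite integralZl//; last exact: integrable_normal_pdf.
by rewrite integral_normal_pdf mule1.
Qed.

(** The function exp (d z^2) is entire and decays like exp (- d y^2) on vertical lines, so the line
    can be moved to abscissa 0, where the integrand is the real Gaussian. *)
Lemma gauss_vline d a : 0 < d ->
  cintegrable mu setT (fun y => cexp (d%:C * ((a +i* y) * (a +i* y)))) /\
  cintegral mu setT (fun y => cexp (d%:C * ((a +i* y) * (a +i* y)))) =
  (Num.sqrt (pi / d))%:C.
Proof.
move=> d0; pose h x y := cexp (d%:C * ((x +i* y) * (x +i* y))).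
pose h' x y := h x y * (d%:C * (1 * (x +i* y) + (x +i* y) * 1)).
pose M := `|a| + 1.
(* Used at u = y^2. One factor 1 + y^2 yields the Lorentzian, the other absorbs the linear growth of
   (exp (d z^2))' / exp (d z^2) = 2 d z. *)
have [K [K0 HK]] := exp_decay 2 d0.
pose K1 := expR (d * M ^+ 2) * (1 + 2 * d * (M + 1)) * K.
have d0' := ltW d0.
have M0 : 0 <= M by rewrite addr_ge0.
have dh x y : cderiv h x y (h' x y).
  by apply/cderiv_exp/cderivZ/cderivM; exact: cderiv_id.
have cz x : ccontinuous (fun y => x +i* y).
  by apply: cderiv_ccontinuous => y; exact: (cderiv_id x y).
have ch x : ccontinuous (h x) by apply: cderiv_ccontinuous => y; exact: dh.
have ch' x : ccontinuous (h' x).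
  apply: ccontinuousM => //; apply: ccontinuousM; first exact: ccontinuous_cst.
  by apply: ccontinuousD; apply: ccontinuousM => //; exact: ccontinuous_cst.
have dM : 0 <= 2 * d * (M + 1) by rewrite !mulr_ge0// addr_ge0.
(* The factor 1 + 2 d (M + |y|) dominates both 1 and |2 d z|, so this single estimate bounds h and
   h'. *)
have bnd x y : `|x| < M -> normc (h x y) * (1 + 2 * d * (M + `|y|)) <= K1 * lor y.
  move=> xM; have o0 : 0 < oneDsqr y by rewrite (lt_le_trans ltr01)// oneDsqr_ge1.
  rewrite cexp_gauss ler_pdivlMr// /K1 /oneDsqr.
  have y2 : 0 <= y ^+ 2 by exact: sqr_ge0.
  apply: (@le_trans _ _ (expR (d * M ^+ 2) * (1 + 2 * d * (M + 1)) *
    ((1 + y ^+ 2) ^+ 2 * expR (- (d * y ^+ 2))))); last first.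
    by rewrite ler_wpM2l ?HK// mulr_ge0 ?expR_ge0// addr_ge0.
  set g := expR (- _).
  have -> : expR (d * x ^+ 2) * g * (1 + 2 * d * (M + `|y|)) * (1 + y ^+ 2) =
      expR (d * x ^+ 2) * ((1 + 2 * d * (M + `|y|)) * ((1 + y ^+ 2) * g)) by ring.
  have -> : expR (d * M ^+ 2) * (1 + 2 * d * (M + 1)) * ((1 + y ^+ 2) ^+ 2 * g) =
      expR (d * M ^+ 2) * ((1 + 2 * d * (M + 1)) * (1 + y ^+ 2) * ((1 + y ^+ 2) * g)) by ring.
  have g0 : 0 <= g by exact: expR_ge0.
  apply: ler_pM => //; rewrite ?expR_ge0//.
  - have q0 : 0 <= 2 * d * (M + `|y|) by rewrite !mulr_ge0// addr_ge0.
    by rewrite mulr_ge0 ?addr_ge0// mulr_ge0 ?addr_ge0.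
  - by rewrite ler_expR ler_wpM2l// -(real_normK (num_real x)) lerXn2r ?nnegrE// ltW.
  apply: ler_wpM2r; first by rewrite mulr_ge0// addr_ge0.
  have yy : `|y| <= 1 + y ^+ 2.
    rewrite -(real_normK (num_real y)); have := sqr_ge0 (`|y| - 1); have := normr_ge0 y; nra.
  have q : 0 <= d * (M * y ^+ 2 + (1 + y ^+ 2 - `|y|)).
    have q1 : 0 <= 1 + y ^+ 2 - `|y| by rewrite subr_ge0.
    exact: mulr_ge0 d0' (addr_ge0 (mulr_ge0 M0 y2) q1).
  rewrite -subr_ge0 [leRHS](_ : _ = y ^+ 2 + 2 * (d * (M * y ^+ 2 + (1 + y ^+ 2 - `|y|)))).
    by rewrite addr_ge0// mulr_ge0.
  ring.
have bnd1 x y : - M < x < M -> normc (h x y) <= K1 * lor y.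
  rewrite -ltr_norml => xM; apply: le_trans (bnd x y xM).
  by rewrite ler_peMr ?normc_ge0// lerDl !mulr_ge0// addr_ge0.
have bnd2 x y : - M < x < M -> normc (h' x y) <= K1 * lor y.
  rewrite -ltr_norml => xM; apply: le_trans (bnd x y xM).
  rewrite Normc.normcM ler_wpM2l ?normc_ge0// (le_trans (normc_le _))//.
  have -> : d%:C * (1 * (x +i* y) + (x +i* y) * 1) = (2 * d * x) +i* (2 * d * y).
    by apply: complexP; rewrite ?cReM ?cImM ?cReD ?cImD ?cReM ?cImM /=; ring.
  rewrite /= !normrM !(ger0_norm d0') ger0_norm// -mulrDr.
  rewrite (@le_trans _ _ (2 * d * (M + `|y|)))// ?lerDr// ler_wpM2l ?mulr_ge0//.
  by rewrite lerD2r ltW.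
have aM : - M < a < M by rewrite -ltr_norml /M ltrDl.
split; first exact: (line_cintegrable (ch a) (fun y => bnd1 a y aM)).
have O : - M < 0 < M by rewrite oppr_lt0 andbb /M ltr_wpDl.
rewrite (vline_shift (fun x y _ => dh x y) (fun x _ => ch' x) bnd1 bnd2 aM O).
have E y : h 0 y = (expR (- (d * y ^+ 2)))%:C.
  by rewrite /h -cexp_real; congr cexp; apply: complexP;
    rewrite !(cReM, cImM) /=; ring.
under eq_cintegral do rewrite E.
apply: complexP => /=; first exact: gauss_integral0.
by rewrite /Rintegral integral0.
Qed.

(** Completing the square, - d y^2 + i w y = d (w / (2 d) + i y)^2 - w^2 / (4 d): the Fourier
    integral is a line integral at abscissa w / (2 d). *)
Lemma gauss_fourier d w : 0 < d ->
  cintegrable mu setT (fun y => (expR (- (d * y ^+ 2)))%:C * cexp (0 +i* (w * y))) /\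
  cintegral mu setT (fun y => (expR (- (d * y ^+ 2)))%:C * cexp (0 +i* (w * y))) =
  (Num.sqrt (pi / d) * expR (- (w ^+ 2 / (4 * d))))%:C.
Proof.
move=> d0; have [gi ge] := gauss_vline (w / (2 * d)) d0.
have E y : (expR (- (d * y ^+ 2)))%:C * cexp (0 +i* (w * y)) =
    (expR (- (w ^+ 2 / (4 * d))))%:C *
    cexp (d%:C * ((w / (2 * d) +i* y) * (w / (2 * d) +i* y))).
  rewrite -!cexp_real -!cexpD; congr cexp; apply: complexP;
    rewrite !(cReM, cImM, cReD, cImD)/=; field; rewrite gt_eqF//.
under eq_fun do rewrite E; split; first exact: cintegrableZl.
by rewrite cintegralZl// ge -rmorphM mulrC.
Qed.

End gaussian.

(** * Real estimates *)

Section real_decay.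
Variable R : realType.
Implicit Types (x y s k r : R).

Local Notation mu := (@lebesgue_measure R).
Local Notation lor y := (oneDsqr y)^-1.

(** With u = r^s one has y^2 <= r^2 = u^(2 / s), at most a power of 1 + u, so [exp_decay] applies.
    Here r stands for |x + i y|; the factor 1 + r^s makes room for the derivative of the contour
    integrand. *)
Lemma powR_decay s k : 0 < s -> 0 < k -> exists K, 0 < K /\
  forall r y, `|y| <= r -> (1 + r `^ s) * expR (- (k * r `^ s)) <= K * lor y.
Proof.
move=> s0 k0; pose N := Num.truncn (2 / s).
have Ns : 2 / s <= N.+1%:R by rewrite ltW// truncnS_gt.
have [K [K0 HK]] := exp_decay N.+2 k0.
exists (2 * K); split; first by rewrite mulr_gt0.
move=> r y yr; have r0 : 0 <= r by rewrite (le_trans _ yr).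
have o0 : 0 < oneDsqr y by rewrite (lt_le_trans ltr01)// oneDsqr_ge1.
set u := r `^ s; have u0 : 0 <= u by exact: powR_ge0.
have u1 : 1 <= 1 + u by rewrite lerDl.
have e0 := expR_ge0 (- (k * u)).
have y2 : y ^+ 2 <= (1 + u) ^+ N.+1.
  apply: (@le_trans _ _ (r ^+ 2)).
    by rewrite -(real_normK (num_real y)) lerXn2r ?nnegrE.
  have -> : r ^+ 2 = u `^ (2 / s).
    by rewrite -powRrM mulrC divfK ?gt_eqF// powR_mulrn.
  apply: (@le_trans _ _ ((1 + u) `^ (2 / s))).
    by apply: ge0_ler_powR; rewrite ?nnegrE ?divr_ge0 ?(ltW s0) ?addr_ge0// lerDr.
  by rewrite -powR_mulrn ?ler_powR// addr_ge0.
rewrite ler_pdivlMr// mulrAC.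
have h : oneDsqr y <= 2 * (1 + u) ^+ N.+1.
  by rewrite mulrDl mul1r lerD// exprn_ege1.
rewrite (le_trans (ler_wpM2r e0 (ler_wpM2l (le_trans ler01 u1) h)))//.
by rewrite mulrCA -exprS -mulrA ler_wpM2l// HK.
Qed.

Lemma cvg_exp_powR x s k : 0 < s -> 0 < k -> 0 < x ->
  expR (- (k * (x + y) `^ s)) @[y --> +oo] --> 0.
Proof.
move=> s0 k0 x0; apply/cvgrPdist_le => e e0.
near=> y; have y0 : 0 < y by near: y; exact: nbhs_pinfty_gt.
rewrite sub0r normrN ger0_norm ?expR_ge0// expRN.
have ke : (k * e)^-1 <= (x + y) `^ s.
  have ke0 : 0 <= (k * e)^-1 by rewrite invr_ge0 mulr_ge0 ?ltW.
  have -> : (k * e)^-1 = ((k * e)^-1 `^ s^-1) `^ s.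
    by rewrite -powRrM mulVf ?gt_eqF// powRr1.
  apply: ge0_ler_powR; rewrite ?nnegrE ?powR_ge0 ?(ltW s0) ?addr_ge0 ?(ltW x0) ?(ltW y0)//.
  rewrite ler_wpDl ?(ltW x0)//; near: y; exact: nbhs_pinfty_ge.
rewrite invf_ple ?posrE ?expR_gt0// (le_trans _ (expR_ge1Dx _))//.
rewrite ler_wpDl//; move: ke; rewrite invfM mulrC ler_pdivrMr//.
by rewrite mulrC.
Unshelve. all: end_near. Qed.

(* [(x + y) `^ (s - 1) * expR (- (k * (x + y) `^ s))] is the derivative of
   [- expR (- (k * (x + y) `^ s)) / (k * s)]. *)
Lemma integral_powR_exp x s k : 0 < s -> 0 < k -> 0 < x ->
  let q := fun y => (x + `|y|) `^ (s - 1) * expR (- (k * (x + `|y|) `^ s)) in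
  mu.-integrable setT (EFin \o q) /\ \int[mu]_y q y <= 2 / (k * s).
Proof.
move=> s0 k0 x0 q.
have xy y : 0 < x + `|y| by rewrite ltr_wpDr.
have q0 y : 0 <= q y by rewrite mulr_ge0 ?powR_ge0 ?expR_ge0.
have cq : continuous q.
  move=> y; pose p w := w `^ (s - 1) * expR (- (k * w `^ s)).
  have cp : {for x + `|y|, continuous p}.
    apply/differentiable_continuous/derivable1_diffP.
    have d1 := is_derive1_powR (s - 1) (xy y).
    have d2 := is_derive1_powR s (xy y).
    have d3 := is_deriveN (is_deriveZ k d2).
    have d4 := @is_derive1_comp _ (@expR R) _ _ _ _ (is_derive_expR _) d3.
    exact: (@ex_derive _ _ _ _ _ _ _ (is_deriveM d1 d4)).
  apply: (@continuous_comp _ _ _ (fun y => x + `|y|) p) => //.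
  by apply: cvgD; [exact: cvg_cst|exact: norm_continuous].
pose F y := - (expR (- (k * (x + y) `^ s)) / (k * s)).
have dF y : - x < y -> is_derive y 1 F ((x + y) `^ (s - 1) * expR (- (k * (x + y) `^ s))).
  rewrite -subr_gt0 opprK addrC => xy0.
  have d0 : is_derive y 1 (fun y => x + y) 1.
    by apply: is_derive_eq; rewrite add0r mulr1.
  have d2 := @is_derive1_comp _ (fun w : R => w `^ s) (fun y => x + y) y _ _ (is_derive1_powR s xy0) d0.
  have d3 := is_deriveN (is_deriveZ k d2).
  have d4 := @is_derive1_comp _ (@expR R) _ _ _ _ (is_derive_expR _) d3.
  have d5 := is_deriveZ (- (k * s)^-1) d4.
  have -> : F = (- (k * s)^-1) \*: (@expR R \o (fun y => - (k * (x + y) `^ s))).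
    by apply/funext => z; rewrite /F /GRing.scale_fun /GRing.scale/= mulNr mulrC.
  apply: is_derive_eq; rewrite /GRing.scale/=.
  by field; rewrite !gt_eqF.
have E : (\int[mu]_(y in `[0%R, +oo[) (q y)%:E =
    (expR (- (k * x `^ s)) / (k * s))%:E)%E.
  rewrite (@ge0_continuous_FTC2y _ q F 0 0).
  - by rewrite /F addr0 sub0e -EFinN opprK.
  - by move=> y _; exact: q0.
  - exact: continuous_subspaceT.
  - rewrite -oppr0; apply: cvgN; rewrite -[X in _ --> X](mul0r (k * s)^-1).
    by apply: cvgMl; exact: cvg_exp_powR.
  - move=> y y0; have h : - x < y by rewrite (lt_trans _ y0)// oppr_lt0.
    by have := dF y h => dy; exact: ex_derive.
  - have h : - x < 0 by rewrite oppr_lt0.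
    apply/cvg_at_right_filter/differentiable_continuous/derivable1_diffP.
    by have := dF 0 h => dy; exact: ex_derive.
  - move=> y; rewrite in_itv/= andbT => y0; have h : - x < y.
      by rewrite (lt_trans _ y0)// oppr_lt0.
    rewrite derive1E; have := dF y h => dy.
    by rewrite derive_val /q gtr0_norm.
have E2 : (\int[mu]_y (q y)%:E = (2 * (expR (- (k * x `^ s)) / (k * s)))%:E)%E.
  rewrite ge0_symfun_integralT//; first by rewrite -set_itvcy E.
  by move=> y; rewrite /q/= normrN.
split.
  apply/integrableP; split.
    by apply/measurable_EFinP; exact: continuous_measurable_fun.
  by under eq_integral do rewrite gee0_abs ?lee_fin//; rewrite E2 ltry.
rewrite /Rintegral E2/= ler_wpM2l// ler_pdivrMr ?mulr_gt0// mulVf ?gt_eqF ?mulr_gt0//.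
by rewrite -expR0 ler_expR oppr_le0 mulr_ge0 ?powR_ge0 ?(ltW k0).
Qed.

(** The majorant in tau for both subordination integrals. The exponent is what remains for n = 1: 1
    / tau from the subordinator times tau^(-1/2) from the heat kernel. *)
Lemma integrable_powRN32 :
  mu.-integrable `]0%R, +oo[ (fun x => ((1 + x) `^ (- (3 / 2)))%:E).
Proof.
pose F x : R := - (2 * (1 + x) `^ (- (1 / 2))).
have d x : -1 < x -> is_derive x 1 F ((1 + x) `^ (- (3 / 2))).
  rewrite -subr_gt0 opprK addrC => x0.
  have d0 : is_derive x 1 (fun y => 1 + y) 1.
    by apply: is_derive_eq; rewrite add0r mulr1.
  have d1 := @is_derive1_comp _ (fun w : R => w `^ (- (1 / 2))) (fun y => 1 + y) x _ _ (is_derive1_powR _ x0) d0.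
  have d2 := is_deriveZ (- 2) d1.
  have -> : F = (- 2) \*: ((fun w : R => w `^ (- (1 / 2))) \o (fun y => 1 + y)).
    by apply/funext => z; rewrite /F /GRing.scale_fun /GRing.scale/= mulNr.
  apply: is_derive_eq; rewrite /GRing.scale/= mulr1 mulrA.
  have -> : - 2 * (- (1 / 2)) = 1 :> R by field.
  by rewrite !mul1r; congr powR; field.
have cF x : -1 < x -> {for x, continuous F}.
  move=> x1; apply/differentiable_continuous/derivable1_diffP.
  by have := d x x1 => dx; exact: ex_derive.
have cp x : -1 < x -> {for x, continuous (fun x : R => (1 + x) `^ (- (3 / 2)))}.
  rewrite -subr_gt0 opprK addrC => x0.
  apply/differentiable_continuous/derivable1_diffP.
  have d0 : is_derive x 1 (fun y => 1 + y) 1.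
    by apply: is_derive_eq; rewrite add0r mulr1.
  have d1 := @is_derive1_comp _ (fun w : R => w `^ (- (3 / 2))) (fun y => 1 + y) x _ _ (is_derive1_powR _ x0) d0.
  exact: (@ex_derive _ _ _ _ _ _ _ d1).
have g x : 0 <= x -> -1 < x :> R by apply: lt_le_trans; rewrite oppr_lt0.
suff E : (\int[mu]_(x in `[0%R, +oo[) ((1 + x) `^ (- (3 / 2)))%:E = 2%:E)%E.
  apply: (@integrableS _ _ _ mu `[0%R, +oo[%classic) => //.
    by apply: subset_itvr; rewrite bnd_simp.
  apply/integrableP; split.
    apply/measurable_EFinP; apply: measurable_funTS.
    have m : measurable_fun setT (fun x : R => 1 + x) by exact: measurable_funD.
    exact: (measurableT_comp (@measurable_powR R (- (3 / 2))) m).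
  by under eq_integral do rewrite gee0_abs ?lee_fin ?powR_ge0//; rewrite E ltry.
rewrite (@ge0_continuous_FTC2y _ _ F 0 0).
- by rewrite /F addr0 powR1 mulr1 sub0e -EFinN opprK.
- by move=> x _; exact: powR_ge0.
- apply/continuous_within_itvcyP; split.
    by move=> x; rewrite in_itv/= andbT => /ltW/g/cp.
  by apply: cvg_at_right_filter; exact/cp/g.
- rewrite -oppr0; apply: cvgN; rewrite -[X in _ --> X](mulr0 2); apply: cvgMr.
  apply/cvgrPdist_le => e e0; near=> y.
  have y0 : 0 < y by near: y; exact: nbhs_pinfty_gt.
  rewrite sub0r normrN ger0_norm ?powR_ge0// powRN.
  rewrite invf_ple ?posrE ?powR_gt0 ?addr_gt0//.
  have -> : e^-1 = (e^-1 `^ 2) `^ (1 / 2).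
    rewrite -powRrM (_ : 2 * (1 / 2) = 1) ?powRr1 ?invr_ge0 ?(ltW e0)//; by field.
  apply: ge0_ler_powR; rewrite ?nnegrE ?powR_ge0 ?addr_ge0 ?(ltW y0)//.
  rewrite ler_wpDl//; near: y; by apply: nbhs_pinfty_ge; rewrite num_real.
- by move=> x /ltW/g/d dx; exact: ex_derive.
- by apply: cvg_at_right_filter; exact/cF/g.
- move=> x; rewrite in_itv/= andbT => /ltW/g/d dx.
  by rewrite derive1E derive_val.
Unshelve. all: end_near. Qed.

End real_decay.

(** * The contour integral defining the subordinator *)

Section subordinator.
Variables (R : realType) (s t : R).
Hypotheses (s0 : 0 < s) (s1 : s < 1) (t0 : 0 < t).
Implicit Types (x y tau a : R).

Local Notation mu := (@lebesgue_measure R).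
Local Notation lor y := (oneDsqr y)^-1.

(** The rate at which the contour integrand decays in |z|^s, by [Re_cpow_ge]. *)
Let k := t * cos (s * (pi / 2)).

Let k0 : 0 < k. Proof. by rewrite mulr_gt0// cos_gt0. Qed.

Definition sub_exp tau x y : R[i] :=
  cexp ((x +i* y) * tau%:C - t%:C * cpow (x +i* y) s).

Definition sub_exp' tau x y : R[i] := sub_exp tau x y *
  (tau%:C + - t%:C * (cpow (x +i* y) s * (s%:C / (x +i* y)))).

Lemma cderiv_sub_exp tau x y : 0 < x ->
  cderiv (sub_exp tau) x y (sub_exp' tau x y).
Proof.
move=> x0; apply: cderiv_exp.
have := cderivD (cderivZ tau%:C (cderiv_id x y)) (cderivZ (- t%:C) (cderiv_pow s y x0)).
by rewrite mulr1; congr (cderiv _ _ _ _); apply/funext => u; apply/funext => v;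
  rewrite mulrC mulNr.
Qed.

Lemma normc_sub_exp tau x y : 0 < x ->
  normc (sub_exp tau x y) <= expR (x * tau) * expR (- (k * normc (x +i* y) `^ s)).
Proof.
move=> x0; rewrite normc_cexp -expRD ler_expR.
have -> : Re ((x +i* y) * tau%:C - t%:C * cpow (x +i* y) s) =
    x * tau - t * Re (cpow (x +i* y) s).
  by rewrite cReD cReN !cReM; case: (cpow _ _) => p q /=; ring.
rewrite lerD2l lerN2 -mulrA ler_wpM2l ?(ltW t0)//; exact: Re_cpow_ge.
Qed.

Lemma normc_cpow_div x y : 0 < x ->
  normc (cpow (x +i* y) s * (s%:C / (x +i* y))) =
  s * (normc (x +i* y) `^ s / normc (x +i* y)).
Proof.
move=> x0; rewrite Normc.normcM normc_cpow// Normc.normcM Normc.normcV normc_real.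
by rewrite ger0_norm ?(ltW s0)// mulrCA.
Qed.

Lemma normc_ge_y x y : `|y| <= normc (x +i* y).
Proof. exact: normc_Im (x +i* y). Qed.

Lemma normc_ge_x x y : x <= normc (x +i* y).
Proof. by rewrite (le_trans (ler_norm x))// (normc_Re (x +i* y)). Qed.

Lemma ccontinuous_sub_exp tau x : 0 < x -> ccontinuous (sub_exp tau x).
Proof. by move=> x0; apply: cderiv_ccontinuous => y; exact: cderiv_sub_exp. Qed.

Lemma ccontinuous_cpow_div x : 0 < x ->
  ccontinuous (fun y => cpow (x +i* y) s * (s%:C / (x +i* y))).
Proof.
move=> x0; apply: ccontinuousM.
  by apply: (@cderiv_ccontinuous _ (fun x y => cpow (x +i* y) s)) => y; exact: cderiv_pow.
apply: ccontinuousM; first exact: ccontinuous_cst.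
have n y : x ^+ 2 + y ^+ 2 != 0 by rewrite gt_eqF// ltr_wpDr ?sqr_ge0// exprn_gt0.
have cq : continuous (fun y => (x ^+ 2 + y ^+ 2)^-1).
  move=> y; apply: cvgV; first exact: n.
  by apply: cvgD; [exact: cvg_cst|exact: exprn_continuous].
split=> y /=.
- by apply: cvgM; [exact: cvg_cst|exact: cq].
- by apply: cvgN; apply: cvgM; [exact: cvg_id|exact: cq].
Qed.

Lemma ccontinuous_sub_exp' tau x : 0 < x -> ccontinuous (sub_exp' tau x).
Proof.
move=> x0; apply: ccontinuousM; first exact: ccontinuous_sub_exp.
apply: ccontinuousD; first exact: ccontinuous_cst.
by apply: ccontinuousM; [exact: ccontinuous_cst|exact: ccontinuous_cpow_div].
Qed.

(** Both ends of the strip matter: C bounds exp (x tau), and A > 0 bounds the factor 1 / |z| in the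
    derivative of z^s. *)
Lemma sub_exp_bounds tau A C : 0 < A -> exists K, forall x y, A < x < C ->
  normc (sub_exp tau x y) <= K * lor y /\ normc (sub_exp' tau x y) <= K * lor y.
Proof.
move=> A0; have [K [K0 HK]] := powR_decay s0 k0.
(* The logarithmic derivative tau - t s z^(s - 1) is at most |tau| + (t s / A) r^s, hence at most D
   (1 + r^s). *)
pose D := 1 + (`|tau| + t * s / A).
have D1 : 1 <= D by rewrite lerDl addr_ge0// divr_ge0 ?mulr_ge0 ?ltW.
have D0 : 0 <= D by exact: le_trans D1.
exists (expR (C * `|tau|) * D * K) => x y /andP[Ax xC].
have x0 : 0 < x by exact: lt_trans Ax.
have C0 : 0 < C by exact: lt_trans xC.
set r := normc (x +i* y); set u := r `^ s.
have u0 : 0 <= u by exact: powR_ge0.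
have Ar : A <= r by rewrite (le_trans (ltW Ax))// normc_ge_x.
have r0 : 0 < r by exact: lt_le_trans Ar.
have e1 : expR (x * tau) <= expR (C * `|tau|).
  rewrite ler_expR (le_trans (ler_norm _))// normrM (gtr0_norm x0).
  by rewrite ler_wpM2r// ltW.
have b1 : normc (sub_exp tau x y) <= expR (C * `|tau|) * expR (- (k * u)).
  by rewrite (le_trans (normc_sub_exp tau y x0))// ler_wpM2r// expR_ge0.
have b2 : normc (tau%:C + - t%:C * (cpow (x +i* y) s * (s%:C / (x +i* y)))) <=
    D * (1 + u).
  rewrite (le_trans (le_normcD _ _))// normc_real Normc.normcM normcN normc_real.
  rewrite (gtr0_norm t0) normc_cpow_div// -/r -/u.
  apply: (@le_trans _ _ (`|tau| + t * s / A * u)).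
    rewrite lerD2l -!mulrA ler_wpM2l ?(ltW t0)// ler_wpM2l ?(ltW s0)//.
    by rewrite mulrC ler_wpM2r// lef_pV2.
  rewrite /D !mulrDl !mulrDr !mul1r !mulr1 -subr_ge0.
  rewrite [leRHS](_ : _ = 1 + u + `|tau| * u + t * s / A); last by ring.
  by rewrite !addr_ge0// ?mulr_ge0 ?invr_ge0 ?(ltW t0) ?(ltW s0) ?(ltW A0).
have H := HK r y (normc_ge_y x y); rewrite -/u in H.
have Ce : 0 <= expR (C * `|tau|) by exact: expR_ge0.
have be : 0 <= expR (- (k * u)) by exact: expR_ge0.
have -> : expR (C * `|tau|) * D * K * lor y = expR (C * `|tau|) * (D * (K * lor y)).
  by rewrite !mulrA.
split.
- apply: (le_trans b1); rewrite ler_wpM2l//.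
  apply: (@le_trans _ _ (1 * ((1 + u) * expR (- (k * u))))).
    by rewrite mul1r ler_peMl// lerDl.
  by apply: ler_pM => //; rewrite mulr_ge0// addr_ge0.
- rewrite Normc.normcM.
  apply: (le_trans (ler_pM (normc_ge0 _) (normc_ge0 _) b1 b2)).
  have -> : expR (C * `|tau|) * expR (- (k * u)) * (D * (1 + u)) =
    expR (C * `|tau|) * (D * ((1 + u) * expR (- (k * u)))) by ring.
  by rewrite ler_wpM2l// ler_wpM2l.
Qed.

Lemma sub_exp_cintegrable tau a : 0 < a -> cintegrable mu setT (sub_exp tau a).
Proof.
move=> a0; have a20 : 0 < a / 2 by rewrite divr_gt0.
have [K HK] := sub_exp_bounds tau (a + 1) a20.
apply: (line_cintegrable (ccontinuous_sub_exp tau a0) (K := K)) => y.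
have h : a / 2 < a < a + 1 by rewrite ltrDl ltr01 andbT ltr_pdivrMr// mulr_natr mulr2n ltrDl.
by have [] := HK a y h.
Qed.

Lemma sub_exp_shift tau a b : 0 < a -> 0 < b ->
  cintegral mu setT (sub_exp tau a) = cintegral mu setT (sub_exp tau b).
Proof.
move=> a0 b0.
pose m := Num.min a b / 2; pose M := Num.max a b + 1.
have mab : 0 < Num.min a b by rewrite lt_min a0.
have m0 : 0 < m by rewrite divr_gt0.
have mm : m < Num.min a b by rewrite ltr_pdivrMr// mulr_natr mulr2n ltrDl.
have [K HK] := sub_exp_bounds tau M m0.
have pos x : m < x < M -> 0 < x by case/andP => /(lt_trans m0).
apply: (@vline_shift _ (sub_exp tau) (sub_exp' tau) m M K).
- by move=> x y /pos x0; exact: cderiv_sub_exp.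
- by move=> x /pos x0; exact: ccontinuous_sub_exp'.
- by move=> x y xM; have [] := HK x y xM.
- by move=> x y xM; have [] := HK x y xM.
- by rewrite (lt_le_trans mm) ?ge_min ?lexx//= /M (@le_lt_trans _ _ (Num.max a b)) ?le_max ?lexx// ltrDl.
- by rewrite (lt_le_trans mm) ?ge_min ?lexx ?orbT//= /M (@le_lt_trans _ _ (Num.max a b)) ?le_max ?lexx ?orbT// ltrDl.
Qed.

(* Integration by parts on the line of abscissa [a]; in this form the bound is
   small both for [tau < 0], letting [a] grow, and for small or large
   [tau > 0], taking [a = 1 / tau]. *)
Lemma sub_exp_parts : exists C, forall a tau, 0 < a ->
  `|tau| * normc (cintegral mu setT (sub_exp tau a)) <=
  C * expR (a * tau - k / 2 * a `^ s).
Proof.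
(* Half of the rate k is spent on r >= a. The other half meets rho = a + |y| <= 2 r, where s < 1
   gives r^s >= rho^s / 2; hence k / 4. *)
pose q a y := (a + `|y|) `^ (s - 1) * expR (- (k / 4 * (a + `|y|) `^ s)).
have k40 : 0 < k / 4 by rewrite divr_gt0.
exists (2 * (t * s * 2 * (2 / (k / 4 * s)))) => a tau a0.
(* This bound on the integral of [q a] is independent of a. Such uniformity is the gain from
   integrating by parts: the new weight z^(s - 1) makes the majorant an exact derivative. *)
have [iq Iq] := integral_powR_exp s0 k40 a0; rewrite -/(q a) in iq Iq.
have a20 : 0 < a / 2 by rewrite divr_gt0.
have [K HK] := sub_exp_bounds tau (a + 1) a20.
have h : a / 2 < a < a + 1 by rewrite ltrDl ltr01 andbT ltr_pdivrMr// mulr_natr mulr2n ltrDl.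
(* As [sub_exp'] is (tau - w) times [sub_exp] and integrates to 0, tau times the contour integral
   equals the integral of G. *)
pose w y := t%:C * (cpow (a +i* y) s * (s%:C / (a +i* y))).
pose G y := sub_exp tau a y * w y.
have I0 : cintegral mu setT (sub_exp' tau a) = 0.
  apply: (@cintegral_cderiv_eq0 _ (sub_exp tau) a (sub_exp' tau a) K).
  - by move=> y; exact: cderiv_sub_exp.
  - exact: ccontinuous_sub_exp'.
  - by move=> y; have [] := HK a y h.
  - by move=> y; have [] := HK a y h.
have GE y : G y = tau%:C * sub_exp tau a y + (-1) * sub_exp' tau a y.
  by rewrite /G /w /sub_exp'; ring.
have ih := sub_exp_cintegrable tau a0.
have ih' : cintegrable mu setT (sub_exp' tau a).
  apply: (line_cintegrable (ccontinuous_sub_exp' tau a0) (K := K)) => y.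
  by have [] := HK a y h.
have iG : cintegrable mu setT G.
  apply: eq_cintegrable (cintegrableD _ (cintegrableZl tau%:C _ ih) (cintegrableZl (-1) _ ih')) => //.
have IG : cintegral mu setT G = tau%:C * cintegral mu setT (sub_exp tau a).
  under eq_cintegral do rewrite GE.
  rewrite cintegralD//; [|exact: cintegrableZl|exact: cintegrableZl].
  by rewrite !cintegralZl// I0 mulr0 addr0.
rewrite -normc_real -Normc.normcM -IG.
pose c := expR (a * tau - k / 2 * a `^ s) * (t * s * 2).
have c0 : 0 <= c by rewrite !mulr_ge0 ?expR_ge0 ?(ltW t0) ?(ltW s0).
have Gq y : normc (G y) <= c * q a y.
  have r0 : 0 < normc (a +i* y) by exact: normc_gt0.
  set r := normc (a +i* y) in r0 *; set rho := a + `|y|.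
  have rho0 : 0 < rho by rewrite ltr_wpDr.
  have rr : rho / 2 <= r.
    rewrite ler_pdivrMr// mulr_natr mulr2n lerD//; first exact: normc_ge_x.
    exact: normc_ge_y.
  have r2 : r <= rho.
    by rewrite (le_trans (normc_le _))//= lerD2r gtr0_norm.
  have p1 : r `^ s <= rho `^ s.
    by apply: ge0_ler_powR; rewrite ?nnegrE ?(ltW s0) ?(ltW r0) ?(ltW rho0).
  have p2 : rho `^ s / 2 <= r `^ s.
    apply: (@le_trans _ _ ((rho / 2) `^ s)).
      rewrite powRM ?(ltW rho0)// ler_wpM2l ?powR_ge0//.
      apply: ger1_powR; last exact: ltW.
      by rewrite invr_gt0 ltr0n/= invf_le1 ?ler1n.
    by apply: ge0_ler_powR; rewrite ?nnegrE ?(ltW s0) ?(ltW r0) ?divr_ge0 ?(ltW rho0).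
  have p3 : a `^ s <= r `^ s.
    by apply: ge0_ler_powR; rewrite ?nnegrE ?(ltW s0) ?(ltW r0) ?(ltW a0)// normc_ge_x.
  have p4 : r `^ s / r <= 2 * rho `^ (s - 1).
    have -> : rho `^ (s - 1) = rho `^ s / rho.
      by rewrite powRB ?(gt_eqF rho0) ?implybT// powRr1// ltW.
    apply: (@le_trans _ _ (rho `^ s / (rho / 2))).
      apply: ler_pM; rewrite ?powR_ge0 ?invr_ge0 ?(ltW r0)//.
      by rewrite lef_pV2 ?posrE ?divr_gt0.
    by rewrite invf_div mulrCA mulrC.
  have nw : normc (w y) = t * (s * (r `^ s / r)).
    by rewrite /w Normc.normcM normc_cpow_div// normc_real (gtr0_norm t0).
  rewrite /G Normc.normcM nw.
  apply: (@le_trans _ _ (expR (a * tau) * expR (- (k * r `^ s)) * (t * (s * (2 * rho `^ (s - 1)))))).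
    apply: ler_pM; rewrite ?normc_ge0//.
    - by rewrite !mulr_ge0 ?(ltW t0) ?(ltW s0) ?powR_ge0 ?invr_ge0 ?(ltW r0).
    - exact: normc_sub_exp.
    - by rewrite !ler_wpM2l ?(ltW t0) ?(ltW s0).
  rewrite /c /q -/rho -expRD.
  have -> : expR (a * tau - k / 2 * a `^ s) * (t * s * 2) *
      (rho `^ (s - 1) * expR (- (k / 4 * rho `^ s))) =
      expR (a * tau - k / 2 * a `^ s - k / 4 * rho `^ s) * (t * (s * (2 * rho `^ (s - 1)))).
    by rewrite [expR (_ - k / 4 * _)]expRD; ring.
  rewrite ler_wpM2r ?mulr_ge0 ?(ltW t0) ?(ltW s0) ?powR_ge0// ler_expR -addrA lerD2l.
  rewrite -opprD lerN2.
  have := ler_wpM2l (ltW k0) p3; have := ler_wpM2l (ltW k0) p2; lra.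
have icq : mu.-integrable setT (EFin \o (fun y => c * q a y)).
  exact: (integrableZl measurableT c iq).
rewrite (le_trans (normc_cintegral_le measurableT iG (fun y _ => Gq y) icq))//.
rewrite RintegralZl//.
have -> : 2 * (t * s * 2 * (2 / (k / 4 * s))) * expR (a * tau - k / 2 * a `^ s) =
  2 * (c * (2 / (k / 4 * s))) by rewrite /c; ring.
by rewrite ler_wpM2l// ler_wpM2l.
Qed.

End subordinator.

(** * Contour formula and size of the subordinator *)

Section bochner.
Variables (R : realType) (s t eps : R).
Hypotheses (s0 : 0 < s) (s1 : s < 1) (t0 : 0 < t) (eps0 : 0 < eps).
Implicit Types (x y tau a p : R).

Local Notation mu := (@lebesgue_measure R).
Local Notation lor y := (oneDsqr y)^-1.
Local Notation B := (bochner_subordinator eps s t).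

Lemma le0_of_expR (m C c : R) : 0 < c ->
  (forall x, 0 < x -> m <= C * expR (- (x * c))) -> m <= 0.
Proof.
move=> c0 H; rewrite leNgt; apply/negP => m0.
have C0 : 0 < C.
  by have := lt_le_trans m0 (H 1 ltr01); rewrite pmulr_lgt0// expR_gt0.
(* At this x, m exp (x c) >= m (1 + x c) = m + C > C, a contradiction. *)
have x0 : 0 < C / (m * c) by rewrite divr_gt0// mulr_gt0.
have := H _ x0; rewrite expRN ler_pdivlMr ?expR_gt0//; apply/negP; rewrite -ltNge.
rewrite (@lt_le_trans _ _ (m * (1 + C / (m * c) * c)))//; last first.
  by rewrite ler_wpM2l ?expR_ge1Dx// ltW.
have -> : m * (1 + C / (m * c) * c) = m + C by field; rewrite !gt_eqF.
by rewrite ltrDr.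
Qed.

(** One formula for all real tau, negative ones included: tau-integrals can then run over the whole
    line, where the Fourier transform of the Gaussian applies. *)
Lemma bochnerE a tau : 0 < a ->
  B tau = (2 * pi)^-1%:C * cintegral mu setT (sub_exp s t tau a).
Proof.
move=> a0; rewrite (sub_exp_shift s0 s1 t0 tau a0 eps0) /bochner_subordinator.
have ie := sub_exp_cintegrable s0 s1 t0 tau eps0.
have [tau0|tau0] := leP 0 tau.
  rewrite /vline_integral.
  under eq_cintegral do rewrite mulrC.
  rewrite cintegralZl// mulrA; congr (_ * _).
  rewrite invfM -mulrA mulVf ?mulr1 ?rmorphV//.
    by rewrite unitfE mulf_neq0// gt_eqF// pi_gt0.
  by rewrite eq_complex /= oner_eq0 andbF.
apply/esym; rewrite [X in _ * X](_ : _ = 0) ?mulr0//.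
apply: Normc.eq0_normc; apply/eqP; rewrite eq_le normc_ge0 andbT.
have [C HC] := sub_exp_parts s0 s1 t0.
have nt : 0 < `|tau| by rewrite normr_gt0 lt_eqF.
rewrite -(pmulr_rle0 _ nt).
apply: (@le0_of_expR _ `|C| `|tau|) => // x x0.
rewrite (sub_exp_shift s0 s1 t0 tau eps0 x0) (le_trans (HC x tau x0))//.
apply: (le_trans (ler_wpM2r (expR_ge0 _) (ler_norm C))).
rewrite ler_wpM2l// ler_expR (ltr0_norm tau0) mulrN opprK gerDl oppr_le0.
by rewrite mulr_ge0 ?powR_ge0// divr_ge0// mulr_ge0 ?(ltW t0)// ltW// cos_gt0.
Qed.

(** Near 0 the factor exp (- c tau^-s) beats every power, and at infinity 1 / tau is at most of
    order tau^(p - 3/2) because p >= 1/2. Taken at p = n / 2, the factor tau^p cancels the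
    singularity of the heat kernel. *)
Lemma bochner_bound p : 2^-1 <= p -> exists K, 0 <= K /\ forall tau, 0 < tau ->
  normc (B tau) <= K * (tau `^ p * (1 + tau) `^ (- (3 / 2))).
Proof.
move=> p2; have p0 : 0 < p by rewrite (lt_le_trans _ p2).
have [C HC] := sub_exp_parts s0 s1 t0.
set k := t * cos (s * (pi / 2)) in HC.
have k0 : 0 < k / 2 by rewrite divr_gt0// mulr_gt0// cos_gt0.
(* With v = tau^-s, the power tau^-(p + 1) = v^((p + 1) / s) is at most (1 + v)^N, which [exp_decay]
   controls. *)
pose N := (Num.truncn ((p + 1) / s)).+1.
have Ns : (p + 1) / s <= N%:R by rewrite ltW// truncnS_gt.
have [K [K0 HK]] := exp_decay N k0.
have pi20 : 0 < (2 * pi)^-1 :> R by rewrite invr_gt0 mulr_gt0// pi_gt0.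
exists ((2 * pi)^-1 * (`|C| * expR 1 * K * 2 `^ (3 / 2))); split.
  by rewrite !mulr_ge0 ?expR_ge0 ?powR_ge0// ltW.
move=> tau tau0; have a0 : 0 < tau^-1 by rewrite invr_gt0.
rewrite (bochnerE tau a0) Normc.normcM normc_real (gtr0_norm pi20) -[leRHS]mulrA.
rewrite ler_wpM2l ?(ltW pi20)//.
have := HC _ tau a0; rewrite mulVf ?gt_eqF// (gtr0_norm tau0).
set v := tau^-1 `^ s; set I := normc _ => HI.
have v0 : 0 <= v by exact: powR_ge0.
have v1 : 0 < (1 + v) ^+ N by rewrite exprn_gt0// ltr_wpDr.
have {}HK := HK v v0.
set S := (1 + tau) `^ (3 / 2).
have S0 : 0 < S by rewrite powR_gt0// addr_gt0.
(* For tau >= 1 use 1 + tau <= 2 tau and p + 1 >= 3/2; for tau <= 1 use 1 + tau <= 2 and tau^(p + 1)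
   (1 + v)^N >= 1. *)
have claim : S <= 2 `^ (3 / 2) * (tau `^ (p + 1) * (1 + v) ^+ N).
  have h32 : 0 <= 3 / 2 :> R by rewrite divr_ge0.
  have [tau1|/ltW tau1] := leP 1 tau.
    apply: (@le_trans _ _ ((2 * tau) `^ (3 / 2))).
      apply: ge0_ler_powR; rewrite ?nnegrE ?addr_ge0 ?mulr_ge0 ?(ltW tau0)//.
      by rewrite mulrDl mul1r lerD2r.
    rewrite powRM ?(ltW tau0)// ler_wpM2l ?powR_ge0//.
    apply: (@le_trans _ _ (tau `^ (p + 1))).
      by apply: ler_powR => //; lra.
    by rewrite ler_peMr ?powR_ge0// exprn_ege1// lerDl.
  rewrite -[leLHS]mulr1 ler_pM ?(ltW S0)//.
    have h12 : 1 + tau <= 2 by lra.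
    by apply: ge0_ler_powR; rewrite ?nnegrE ?addr_ge0 ?(ltW tau0).
  apply: (@le_trans _ _ (tau `^ (p + 1) * tau^-1 `^ (p + 1))).
    by rewrite -powRM ?(ltW tau0) ?(ltW a0)// divff ?gt_eqF// powR1.
  rewrite ler_wpM2l ?powR_ge0//.
  have -> : tau^-1 `^ (p + 1) = v `^ ((p + 1) / s).
    by rewrite /v -powRrM mulrC divfK ?gt_eqF.
  apply: (@le_trans _ _ ((1 + v) `^ ((p + 1) / s))).
    apply: ge0_ler_powR; rewrite ?nnegrE ?addr_ge0// ?lerDr//.
    by rewrite divr_ge0 ?addr_ge0 ?(ltW p0) ?(ltW s0).
  by rewrite -powR_mulrn ?addr_ge0// ler_powR// lerDl.
have HI2 : tau * I <= `|C| * expR 1 * K * ((1 + v) ^+ N)^-1.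
  apply: (le_trans HI); rewrite expRD.
  apply: (@le_trans _ _ (`|C| * (expR 1 * expR (- (k / 2 * v))))).
    by rewrite ler_wpM2r ?ler_norm// mulr_ge0 ?expR_ge0.
  have -> : `|C| * expR 1 * K / (1 + v) ^+ N = `|C| * (expR 1 * (K / (1 + v) ^+ N)).
    by rewrite !mulrA.
  rewrite ler_wpM2l// ler_wpM2l ?expR_ge0//.
  by rewrite ler_pdivlMr// mulrC.
have -> : tau `^ p * (1 + tau) `^ (- (3 / 2)) = tau^-1 * (tau `^ (p + 1) / S).
  have -> : tau `^ (p + 1) = tau * tau `^ p.
    by rewrite -(@mulr_powRB1 _ tau (p + 1)) ?(ltW tau0) ?addr_gt0// addrK.
  rewrite powRN -/S.
  by rewrite !mulrA mulVf ?gt_eqF// mul1r.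
rewrite -(ler_pM2l tau0) (le_trans HI2)//.
have -> : tau * (`|C| * expR 1 * K * 2 `^ (3 / 2) * (tau^-1 * (tau `^ (p + 1) / S))) =
   `|C| * expR 1 * K * (2 `^ (3 / 2) * tau `^ (p + 1) / S).
  by field; rewrite !gt_eqF.
apply: ler_wpM2l; first by rewrite !mulr_ge0 ?expR_ge0// ltW.
by rewrite ler_pdivlMr// mulrC ler_pdivrMr// -mulrA.
Qed.

End bochner.

(** * The Laplace transform of the subordinator *)

Lemma cmeasurable_comp d1 d2 (T1 : measurableType d1) (T2 : measurableType d2)
    (R : realType) (f : T2 -> R[i]) (g : T1 -> T2) :
  cmeasurable setT f -> measurable_fun setT g -> cmeasurable setT (f \o g).
Proof.
by move=> [f1 f2] mg; split; [exact: measurableT_comp f1 mg|exact: measurableT_comp f2 mg].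
Qed.

Section gaussian_regularization.
Variables (R : realType) (s t eps : R).
Hypotheses (s0 : 0 < s) (s1 : s < 1) (t0 : 0 < t) (eps0 : 0 < eps).
Implicit Types (x y tau lam delta : R).

Local Notation mu := (@lebesgue_measure R).
Local Notation TR := (measurableTypeR R).
Local Notation lor y := (oneDsqr y)^-1.
Local Notation B := (bochner_subordinator eps s t).

(** The factor 1 + tau^2 pays for removing the Gaussian: 1 - exp (- e^2 tau^2) is small only up to a
    factor growing like tau^2. *)
Lemma bochner_decay lam : 0 < lam -> exists K, 0 <= K /\ forall tau,
  normc (B tau) * expR (- (lam * tau)) * (1 + tau ^+ 2) <= K * lor tau.
Proof.
move=> lam0.
have h12 : 2^-1 <= 2 :> R by lra.
have [K1 [K10 HK1]] := bochner_bound s0 s1 t0 eps0 h12.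
(* Two powers of 1 + tau for [bochner_bound] at p = 2, two for 1 + tau^2, two for the Lorentzian. *)
have [K2 [K20 HK2]] := exp_decay 6 lam0.
have K12 : 0 <= K1 * K2 by rewrite mulr_ge0// ltW.
(* The second term serves tau = 0, which [bochner_bound] leaves out. *)
exists (K1 * K2 + normc (B 0)); split; first by rewrite addr_ge0// normc_ge0.
move=> tau; have o0 : 0 < oneDsqr tau by rewrite (lt_le_trans ltr01)// oneDsqr_ge1.
rewrite ler_pdivlMr// -[1 + tau ^+ 2]/(oneDsqr tau).
have [tau0|tau0|<-] := ltgtP 0 tau.
- apply: (@le_trans _ _ (K1 * K2)); last by rewrite lerDl normc_ge0.
  have a1 : 1 <= 1 + tau by rewrite lerDl ltW.
  have a0 : 0 <= 1 + tau by exact: le_trans a1.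
  have b1 : normc (B tau) <= K1 * (1 + tau) ^+ 2.
    apply: (le_trans (HK1 _ tau0)); rewrite ler_wpM2l//.
    rewrite -[leRHS]mulr1 ler_pM ?powR_ge0//.
      rewrite -(powR_mulrn 2 a0); apply: ge0_ler_powR; rewrite ?nnegrE ?(ltW tau0)//.
      by rewrite lerDr.
    rewrite powRN invf_le1 ?powR_gt0 ?addr_gt0//.
    have h32 : 0 <= 3 / 2 :> R by rewrite divr_ge0.
    by have := ler_powR a1 h32; rewrite powRr0.
  have b2 : oneDsqr tau <= (1 + tau) ^+ 2.
    rewrite /oneDsqr sqrrD expr1n mul1r -addrA lerD2l lerDr.
    by rewrite mulrn_wge0// ltW.
  have := HK2 _ (ltW tau0) => b3.
  apply: (@le_trans _ _ (K1 * ((1 + tau) ^+ 6 * expR (- (lam * tau))))); last first.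
    by rewrite ler_wpM2l.
  have -> : K1 * ((1 + tau) ^+ 6 * expR (- (lam * tau))) =
    K1 * (1 + tau) ^+ 2 * expR (- (lam * tau)) * (1 + tau) ^+ 2 * (1 + tau) ^+ 2 by ring.
  have e0 := expR_ge0 (- (lam * tau)); have n0 := normc_ge0 (B tau).
  apply: ler_pM; rewrite ?mulr_ge0 ?(ltW o0)//.
  apply: ler_pM; rewrite ?mulr_ge0 ?(ltW o0)//.
  exact: ler_wpM2r.
- have -> : B tau = 0 by rewrite /bochner_subordinator leNgt tau0.
  rewrite Normc.normc0 !mul0r.
  by rewrite addr_ge0// normc_ge0.
- by rewrite mulr0 oppr0 expR0 /oneDsqr expr0n addr0 !mulr1 lerDr.
Qed.

Lemma sub_exp0E tau lam y :
  (expR (- (lam * tau)))%:C * sub_exp s t tau lam y =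
  cexp (0 +i* (y * tau)) * sub_exp s t 0 lam y.
Proof.
rewrite /sub_exp -cexp_real -!cexpD; congr cexp.
case: (cpow _ _) => p q; apply: complexP; rewrite !(cReD, cReM, cImD, cImM, cReN, cImN)/=; ring.
Qed.

Lemma gauss_fourierC delta y : 0 < delta ->
  cintegral mu setT (fun tau => (expR (- (delta * tau ^+ 2)))%:C * cexp (0 +i* (y * tau))) =
  (Num.sqrt (pi / delta) * expR (- (y ^+ 2 / (4 * delta))))%:C.
Proof. by move=> d0; have [_] := gauss_fourier y d0. Qed.

Lemma gauss_decay delta : 0 < delta -> exists K,
  forall tau, expR (- (delta * tau ^+ 2)) <= K * lor tau.
Proof.
move=> d0; have [K [K0 HK]] := exp_decay 1 d0; exists K => tau.
have o0 : 0 < oneDsqr tau by rewrite (lt_le_trans ltr01)// oneDsqr_ge1.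
by rewrite ler_pdivlMr// mulrC HK// sqr_ge0.
Qed.

Lemma integrable_gauss delta : 0 < delta ->
  mu.-integrable setT (EFin \o (fun tau => expR (- (delta * tau ^+ 2)))).
Proof.
move=> d0; have [K HK] := gauss_decay d0.
apply: (le_integrable measurableT _ _ (integrable_lor K)).
  apply/measurable_EFinP; apply: measurableT_comp => //; apply: measurableT_comp => //.
  by apply: measurable_funM => //; exact: measurable_funX.
move=> tau _ /=; rewrite lee_fin ger0_norm ?expR_ge0//.
by rewrite (le_trans (HK tau))// ler_norm.
Qed.

(** By [sub_exp0E] the double integrand has modulus exp (- delta tau^2) |sub_exp s t 0 lam y|, a
    product of integrable functions. Integrating in tau first leaves the Gaussian's Fourier
    transform. *)
Lemma bochner_fubini delta lam : 0 < delta -> 0 < lam ->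
  let F := fun tau : TR => (expR (- (delta * tau ^+ 2)))%:C *
     ((expR (- (lam * tau)))%:C * ((2 * pi)%:C * B tau)) in
  cintegrable mu setT F /\
  cintegral mu setT F = cintegral mu setT (fun y : TR =>
    sub_exp s t 0 lam y *
    (Num.sqrt (pi / delta) * expR (- (y ^+ 2 / (4 * delta))))%:C).
Proof.
move=> d0 lam0 F.
pose l : {sigma_finite_measure set TR -> \bar R} := mu.
pose G (z : TR * TR) : R[i] := sub_exp s t 0 lam z.2 *
  ((expR (- (delta * z.1 ^+ 2)))%:C * cexp (0 +i* (z.2 * z.1))).
have mg : cmeasurable (T := TR) setT (sub_exp s t 0 lam).
  exact/ccontinuous_measurable/ccontinuous_sub_exp.
have mG : cmeasurable setT G.
  apply: cmeasurableM; first exact: (cmeasurable_comp mg measurable_snd).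
  apply: cmeasurableM.
    apply: cmeasurable_real; apply: measurableT_comp => //; apply: measurableT_comp => //.
    by apply: measurable_funM => //; apply: measurable_funX; exact: measurable_fst.
  apply: cmeasurable_cexp; split => /=; first exact: measurable_cst.
  by apply: measurable_funM; [exact: measurable_snd|exact: measurable_fst].
have l2 : 0 < lam / 2 by rewrite divr_gt0.
have hl : lam / 2 < lam < lam + 1.
  by rewrite ltrDl ltr01 andbT ltr_pdivrMr// mulr_natr mulr2n ltrDl.
have [K HK] := sub_exp_bounds s0 s1 t0 0 (lam + 1) l2.
have iG : cintegrable (l \x l)%E setT G.
  apply: (@cintegrable_prod _ _ _ _ _ l l G
    (fun tau => expR (- (delta * tau ^+ 2))) (fun y => K * lor y)) => //.
  - move=> tau y; have -> : normc (G (tau, y)) =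
        expR (- (delta * tau ^+ 2)) * normc (sub_exp s t 0 lam y).
      rewrite /G Normc.normcM mulrC; congr (_ * _).
      by rewrite Normc.normcM normc_cexp expR0 mulr1 normc_real ger0_norm ?expR_ge0.
    rewrite ler_wpM2l ?expR_ge0//.
    by have [] := HK lam y hl.
  - exact: integrable_gauss.
  - exact: integrable_lor.
have [iF eF] := cfubini1 iG; have [_ eF2] := cfubini2 iG.
have pi20 : 2 * pi != 0 :> R by rewrite mulf_neq0// gt_eqF// pi_gt0.
have FE tau : F tau = cintegral l setT (fun y => G (tau, y)).
  rewrite /F (bochnerE s0 s1 t0 eps0 tau lam0) [(2 * pi)%:C * _]mulrA -rmorphM.
  rewrite divff// mul1r -cintegralZl//; last exact: sub_exp_cintegrable.
  rewrite -cintegralZl//; last by apply: cintegrableZl => //; exact: sub_exp_cintegrable.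
  by apply: eq_cintegral => y _; rewrite sub_exp0E /G/=; ring.
split; first by apply: eq_cintegrable iF => // tau _.
transitivity (cintegral l setT (fun tau => cintegral l setT (fun y => G (tau, y)))).
  by apply: eq_cintegral => tau _.
rewrite eF -eF2; apply: eq_cintegral => y _.
by rewrite /G /= cintegralZl ?gauss_fourierC//; have [] := gauss_fourier y d0.
Qed.

(** Measurability in the parameter tau is a by-product of Fubini: a positive weight times B is
    integrable, and the weight is divided out. *)
Lemma measurable_bochner : cmeasurable (T := TR) setT B.
Proof.
have [/cintegrable_measurable mF _] := bochner_fubini ltr01 ltr01.
have K (a b c : R) (z : R[i]) : a != 0 -> b != 0 -> c != 0 ->
    (a^-1 * b^-1 * c^-1)%:C * (a%:C * (b%:C * (c%:C * z))) = z.
  move=> a0 b0 c0; rewrite !mulrA -!rmorphM.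
  rewrite [X in X%:C * _](_ : _ = 1) ?mul1r//.
  by field; rewrite a0 b0 c0.
pose w (tau : TR) : R :=
  (expR (- (1 * tau ^+ 2)))^-1 * (expR (- (1 * tau)))^-1 * (2 * pi)^-1.
have mw : cmeasurable (T := TR) setT (fun tau => (w tau)%:C).
  apply: cmeasurable_real; apply: measurable_funM => //.
  apply: measurable_funM.
  - under eq_fun do rewrite -expRN opprK mul1r.
    by apply: measurableT_comp => //; exact: measurable_funX.
  - under eq_fun do rewrite -expRN opprK mul1r.
    exact: measurable_expR.
have := cmeasurableM mw mF; congr (cmeasurable _ _); apply/funext => tau.
by rewrite K ?gt_eqF ?expR_gt0 ?mulr_gt0 ?pi_gt0.
Qed.

End gaussian_regularization.

Lemma lipschitz_at0 (R : realType) (f f' : R -> R) (M : R) :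
  (forall y : R, is_derive y 1 f (f' y)) -> (forall y, `|f' y| <= M) ->
  forall y : R, `|f y - f 0| <= M * `|y|.
Proof.
move=> df fM y.
have cf (D : set R) : {within D, continuous f}.
  by apply: continuous_subspaceT => x; apply/differentiable_continuous/derivable1_diffP.
have [y0|/ltW y0] := leP 0 y.
  have [c _ ->] := MVT_segment y0 (fun x _ => df x) (cf _).
  by rewrite subr0 normrM ler_wpM2r.
have [c _] := MVT_segment y0 (fun x _ => df x) (cf _).
by rewrite distrC => ->; rewrite sub0r normrM normrN ler_wpM2r.
Qed.

Lemma le0_of_small (R : realType) (a C : R) :
  (forall e : R, 0 < e -> e <= 1 -> a <= C * e) -> a <= 0.
Proof.
move=> H; rewrite leNgt; apply/negP => a0.
have C0 : 0 < C by have := H 1 ltr01 (lexx 1); rewrite mulr1; exact: lt_le_trans.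
pose e := Num.min 1 (a / (2 * C)).
have e0 : 0 < e by rewrite lt_min ltr01 divr_gt0// mulr_gt0.
have := H e e0; rewrite /e ge_min lexx => /(_ isT).
apply/negP; rewrite -ltNge (@le_lt_trans _ _ (C * (a / (2 * C))))//.
  by rewrite ler_wpM2l ?(ltW C0)// ge_min lexx orbT.
rewrite (_ : C * (a / (2 * C)) = a / 2); last by field; rewrite gt_eqF.
by rewrite ltr_pdivrMr// mulr_natr mulr2n ltrDl.
Qed.

Section laplace.
Variables (R : realType) (s t eps : R).
Hypotheses (s0 : 0 < s) (s1 : s < 1) (t0 : 0 < t) (eps0 : 0 < eps).
Implicit Types (x y tau lam delta e : R).

Local Notation mu := (@lebesgue_measure R).
Local Notation TR := (measurableTypeR R).
Local Notation lor y := (oneDsqr y)^-1.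
Local Notation B := (bochner_subordinator eps s t).

Lemma sub_exp_real lam : 0 < lam ->
  sub_exp s t 0 lam 0 = (expR (- (t * lam `^ s)))%:C.
Proof.
move=> lam0; rewrite /sub_exp -cexp_real; congr cexp.
have -> : cpow (lam +i* 0) s = (lam `^ s)%:C.
  rewrite /cpow clogE// mul0r atan0 expr0n addr0 lnXn// -[ln lam *+ 2]mulr_natr mulfK//.
  by rewrite -[ln lam +i* 0]/((ln lam)%:C) -rmorphM cexp_real /powR gt_eqF.
by rewrite mulr0 sub0r -rmorphM rmorphN.
Qed.

Lemma sub_exp_lipschitz lam : 0 < lam -> exists L, 0 <= L /\ forall y,
  normc (sub_exp s t 0 lam y - sub_exp s t 0 lam 0) <= L * `|y|.
Proof.
move=> lam0; have l2 : 0 < lam / 2 by rewrite divr_gt0.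
have hl : lam / 2 < lam < lam + 1.
  by rewrite ltrDl ltr01 andbT ltr_pdivrMr// mulr_natr mulr2n ltrDl.
have [K HK] := sub_exp_bounds s0 s1 t0 0 (lam + 1) l2.
have K' y : normc (sub_exp' s t 0 lam y) <= `|K|.
  have [_ h] := HK lam y hl; rewrite (le_trans h)// (le_trans (ler_norm _))//.
  rewrite normrM ler_piMr// gtr0_norm ?lor_gt0//; exact: oneDsqrV_le1.
exists (`|K| + `|K|); split; first by rewrite addr_ge0.
move=> y; rewrite (le_trans (normc_le _))// mulrDl.
rewrite cReD cImD cReN cImN; apply: lerD.
- apply: (@lipschitz_at0 _ (fun y => Re (sub_exp s t 0 lam y)) (fun y => - Im (sub_exp' s t 0 lam y))) => z.
    by have [] := cderiv_sub_exp s t 0 z lam0.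
  by rewrite normrN (le_trans (normc_Im _)).
- apply: (@lipschitz_at0 _ (fun y => Im (sub_exp s t 0 lam y)) (fun y => Re (sub_exp' s t 0 lam y))) => z.
    by have [] := cderiv_sub_exp s t 0 z lam0.
  by rewrite (le_trans (normc_Re _)).
Qed.

Lemma cintegral_real (f : R -> R) :
  cintegral mu setT (fun y => (f y)%:C) = (\int[mu]_y f y)%:C.
Proof. by apply: complexP => //=; rewrite /Rintegral integral0. Qed.

(* The Gaussian on the right-hand side has mass [2 * pi] and concentrates at
   the origin as [e] tends to [0]. *)
Lemma approx_identity (g : R -> R[i]) L : 0 <= L ->
  ccontinuous g -> (forall y, normc (g y - g 0) <= L * `|y|) ->
  (exists K, forall y, normc (g y) <= K) ->
  exists C, forall e, 0 < e ->
  normc (cintegral mu setT (fun y => g y *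
    (Num.sqrt (pi / e ^+ 2) * expR (- (y ^+ 2 / (4 * e ^+ 2))))%:C) -
    (2 * pi)%:C * g 0) <= C * e.
Proof.
move=> L0 cg gL [K gK].
(* The 2 is from [normc_cintegral_le], the 8 from |y| [E8 y] <= 8 e, and sqrt (8 pi^2) is A times
   the mass of E8, in which e cancels. *)
exists (2 * (L * (8 * Num.sqrt (8 * pi ^+ 2)))) => e e0.
set A := Num.sqrt (pi / e ^+ 2).
have A0 : 0 <= A by exact: sqrtr_ge0.
have e20 : 0 < e ^+ 2 by rewrite exprn_gt0.
have pi0 := @pi_gt0 R.
have d40 : 0 < (4 * e ^+ 2)^-1 by rewrite invr_gt0 mulr_gt0.
have d80 : 0 < (8 * e ^+ 2)^-1 by rewrite invr_gt0 mulr_gt0.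
pose E4 y := expR (- ((4 * e ^+ 2)^-1 * y ^+ 2)).
(* E4 is the square of E8: one factor absorbs |y|, the other stays integrable. *)
pose E8 y := expR (- ((8 * e ^+ 2)^-1 * y ^+ 2)).
have EE y : expR (- (y ^+ 2 / (4 * e ^+ 2))) = E4 y by rewrite mulrC.
have iAE4 : mu.-integrable setT (EFin \o (fun y => A * E4 y)).
  exact: (integrableZl measurableT A (integrable_gauss d40)).
have cc4 : cmeasurable (T := TR) setT (fun y => (A * E4 y)%:C).
  by apply: cmeasurable_real; apply/measurable_EFinP; exact: measurable_int iAE4.
have i4 : cintegrable mu setT (fun y => (A * E4 y)%:C).
  apply: cintegrable_le iAE4 => // y _.
  by rewrite normc_real ger0_norm// mulr_ge0// expR_ge0.
have I4 : cintegral mu setT (fun y => (A * E4 y)%:C) = (2 * pi)%:C.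
  rewrite cintegral_real RintegralZl//; last exact: integrable_gauss.
  rewrite gauss_integral0// -sqrtrM ?divr_ge0 ?(ltW pi0) ?(ltW e20)//.
  have -> : pi / e ^+ 2 * (pi / (4 * e ^+ 2)^-1) = (2 * pi) ^+ 2.
    by field; rewrite gt_eqF.
  by rewrite sqrtr_sqr ger0_norm// mulr_ge0// ltW.
have ig : cintegrable mu setT (fun y => g y * (A * E4 y)%:C).
  apply: (@cintegrable_le _ _ _ mu setT _ (fun y => K * (A * E4 y))) => //.
  - by apply: cmeasurableM => //; exact: ccontinuous_measurable.
  - move=> y _; rewrite Normc.normcM normc_real ger0_norm ?mulr_ge0 ?expR_ge0//.
    by rewrite ler_wpM2r// mulr_ge0// expR_ge0.
  - exact: (integrableZl measurableT K iAE4).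
under eq_cintegral do rewrite EE.
have -> : cintegral mu setT (fun y => g y * (A * E4 y)%:C) - (2 * pi)%:C * g 0 =
    cintegral mu setT (fun y => (g y - g 0) * (A * E4 y)%:C).
  transitivity (cintegral mu setT (fun y => g y * (A * E4 y)%:C + (- g 0) * (A * E4 y)%:C)).
    by rewrite cintegralD//; [rewrite cintegralZl// I4 mulNr [g 0 * _]mulrC|exact: cintegrableZl].
  by apply: eq_cintegral => y _; rewrite mulrDl.
have i8 : mu.-integrable setT (EFin \o (fun y => L * (A * (8 * e * E8 y)))).
  have h1 := integrableZl measurableT (8 * e) (integrable_gauss d80).
  exact: (integrableZl measurableT L (integrableZl measurableT A h1)).
have bnd y : normc ((g y - g 0) * (A * E4 y)%:C) <= L * (A * (8 * e * E8 y)).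
  rewrite Normc.normcM normc_real ger0_norm ?mulr_ge0 ?expR_ge0//.
  rewrite (le_trans (ler_wpM2r _ (gL y))) ?mulr_ge0 ?expR_ge0//.
  have -> : L * `|y| * (A * E4 y) = L * (A * (`|y| * E4 y)) by ring.
  rewrite ler_wpM2l// ler_wpM2l//.
  have -> : E4 y = E8 y * E8 y by rewrite /E4 /E8 -expRD; congr expR; field; rewrite gt_eqF.
  rewrite mulrA ler_wpM2r ?expR_ge0// /E8 expRN ler_pdivrMr ?expR_gt0//.
  apply: (@le_trans _ _ (8 * e * (1 + (8 * e ^+ 2)^-1 * y ^+ 2))); last first.
    by rewrite ler_wpM2l ?expR_ge1Dx// mulr_ge0// ltW.
  have -> : 8 * e * (1 + (8 * e ^+ 2)^-1 * y ^+ 2) = (8 * e ^+ 2 + `|y| ^+ 2) / e.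
    by rewrite real_normK ?num_real//; field; rewrite gt_eqF.
  rewrite ler_pdivlMr//; have := sqr_ge0 (`|y| - e); have := normr_ge0 y; nra.
have icd : cintegrable mu setT (fun y => (g y - g 0) * (A * E4 y)%:C).
  apply: (@cintegrable_le _ _ _ mu setT _ (fun y => L * (A * (8 * e * E8 y)))) => //.
  apply: cmeasurableM => //; apply: cmeasurableD; last exact: cmeasurable_cst.
  exact: ccontinuous_measurable.
rewrite (le_trans (normc_cintegral_le measurableT icd (fun y _ => bnd y) i8))//.
rewrite RintegralZl//; last exact: (integrableZl measurableT A (integrableZl measurableT (8 * e) (integrable_gauss d80))).
rewrite RintegralZl//; last exact: (integrableZl measurableT (8 * e) (integrable_gauss d80)).
rewrite RintegralZl//; last exact: (integrable_gauss d80).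
rewrite gauss_integral0// -!mulrA ler_wpM2l// ler_wpM2l//.
have -> : A * (8 * (e * Num.sqrt (pi / (8 * e ^+ 2)^-1))) =
    8 * e * (A * Num.sqrt (pi / (8 * e ^+ 2)^-1)) by ring.
rewrite -sqrtrM ?divr_ge0 ?(ltW pi0) ?(ltW e20)//.
have -> : pi / e ^+ 2 * (pi / (8 * e ^+ 2)^-1) = 8 * pi ^+ 2 by field; rewrite gt_eqF.
by rewrite -mulrA [e * _]mulrC.
Qed.

Lemma bochner_laplace_cintegrable lam : 0 < lam ->
  cintegrable mu setT (fun tau : TR => (expR (- (lam * tau)))%:C * B tau).
Proof.
move=> lam0; have [K [K0 HK]] := bochner_decay s0 s1 t0 eps0 lam0.
apply: (cintegrable_le _ _ _ (integrable_lor K)) => //.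
  apply: cmeasurableM; last exact: measurable_bochner.
  apply: cmeasurable_real; apply: measurableT_comp => //; apply: measurableT_comp => //.
move=> tau _; rewrite Normc.normcM normc_real ger0_norm ?expR_ge0// mulrC.
apply: le_trans (HK tau); rewrite ler_peMr ?lerDl ?sqr_ge0//.
by rewrite mulr_ge0 ?normc_ge0 ?expR_ge0.
Qed.

(** Removing the Gaussian on one side and concentrating it on the other both cost an explicit error
    linear in e, so the equality follows from an inequality for all e in ]0, 1]. *)
Lemma bochner_laplace lam : 0 < lam ->
  cintegral mu setT (fun tau : TR => (expR (- (lam * tau)))%:C * B tau) =
  (expR (- (t * lam `^ s)))%:C.
Proof.
move=> lam0; have [K [K0 HK]] := bochner_decay s0 s1 t0 eps0 lam0.
pose Phi (tau : TR) := (expR (- (lam * tau)))%:C * B tau.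
have iPhi : cintegrable mu setT Phi := bochner_laplace_cintegrable lam0.
pose g := sub_exp s t 0 lam.
have cg : ccontinuous g by exact: ccontinuous_sub_exp.
have [L [L0 HL]] := sub_exp_lipschitz lam0.
have gb : exists K, forall y, normc (g y) <= K.
  have l2 : 0 < lam / 2 by rewrite divr_gt0.
  have hl : lam / 2 < lam < lam + 1.
    by rewrite ltrDl ltr01 andbT ltr_pdivrMr// mulr_natr mulr2n ltrDl.
  have [K' HK'] := sub_exp_bounds s0 s1 t0 0 (lam + 1) l2.
  exists `|K'| => y; have [h _] := HK' lam y hl.
  rewrite (le_trans h)// (le_trans (ler_norm _))// normrM ler_piMr//.
  rewrite gtr0_norm ?lor_gt0//; exact: oneDsqrV_le1.
have [C HC] := approx_identity L0 cg HL gb.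
pose I := cintegral mu setT Phi.
pose c := 2 * pi : R.
have c0 : 0 < c by rewrite mulr_gt0// pi_gt0.
pose C1 := 2 * (c * (\int[mu]_y (K * lor y))).
rewrite -sub_exp_real// -/g -/I.
suff : normc (c%:C * (I - g 0)) <= 0.
  rewrite Normc.normcM normc_real gtr0_norm// pmulr_rle0// => h.
  apply/eqP; rewrite -subr_eq0; apply/eqP/Normc.eq0_normc/eqP.
  by rewrite eq_le normc_ge0 andbT.
(* The damping parameter is delta = e^2, since the concentration error is of order sqrt delta. *)
apply: (@le0_of_small _ _ (C1 + C)) => e e0 e1.
have e20 : 0 < e ^+ 2 by rewrite exprn_gt0.
have [iF IF] := bochner_fubini s0 s1 t0 eps0 e20 lam0.
set F := fun tau : TR => _ in iF IF.
have FE tau : F tau = (expR (- (e ^+ 2 * tau ^+ 2)))%:C * (c%:C * Phi tau).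
  by rewrite /F /Phi -/c; ring.
have -> : c%:C * (I - g 0) = (c%:C * I - cintegral mu setT F) +
   (cintegral mu setT F - c%:C * g 0) by ring.
rewrite (le_trans (le_normcD _ _))// mulrDl lerD//; last by rewrite IF; exact: HC.
have -> : c%:C * I - cintegral mu setT F =
    cintegral mu setT (fun tau => c%:C * Phi tau + (-1) * F tau).
  rewrite cintegralD//; [|exact: cintegrableZl|exact: cintegrableZl].
  by rewrite !cintegralZl// mulN1r.
(* By 1 - exp (- x) <= x and e <= 1, the factor 1 - exp (- e^2 tau^2) is at most e (1 + tau^2), and
   [bochner_decay] absorbs 1 + tau^2. *)
have bnd tau : normc (c%:C * Phi tau + (-1) * F tau) <= c * e * (K * lor tau).
  have -> : c%:C * Phi tau + (-1) * F tau =
     (1 - expR (- (e ^+ 2 * tau ^+ 2)))%:C * (c%:C * Phi tau).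
    by rewrite FE rmorphB rmorph1; ring.
  rewrite Normc.normcM normc_real Normc.normcM normc_real (gtr0_norm c0).
  rewrite mulrCA -mulrA ler_wpM2l ?(ltW c0)//.
  have x0 : 0 <= e ^+ 2 * tau ^+ 2 by rewrite mulr_ge0 ?sqr_ge0.
  rewrite ger0_norm; last by rewrite subr_ge0 -expR0 ler_expR oppr_le0.
  apply: (@le_trans _ _ (e * (1 + tau ^+ 2) * normc (Phi tau))).
    apply: ler_wpM2r; first exact: normc_ge0.
    rewrite lerBlDr (@le_trans _ _ (e ^+ 2 * tau ^+ 2 + expR (- (e ^+ 2 * tau ^+ 2))))//.
      by rewrite -lerBlDl (le_trans _ (expR_ge1Dx _)).
    rewrite lerD2r mulrDr mulr1 ler_wpDl ?(ltW e0)//.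
    by rewrite ler_wpM2r ?sqr_ge0// expr2 ler_piMr// ltW.
  rewrite -mulrA ler_wpM2l ?(ltW e0)// mulrC.
  have := HK tau; congr (_ * _ <= _).
  by rewrite /Phi Normc.normcM normc_real ger0_norm ?expR_ge0// mulrC.
have ib : mu.-integrable setT (EFin \o (fun tau => c * e * (K * lor tau))).
  exact: (integrableZl measurableT (c * e) (integrable_lor K)).
have id : cintegrable mu setT (fun tau => c%:C * Phi tau + (-1) * F tau).
  by apply: cintegrableD => //; exact: cintegrableZl.
rewrite (le_trans (normc_cintegral_le measurableT id (fun y _ => bnd y) ib))//.
by rewrite RintegralZl//; [rewrite /C1 -!mulrA [e * _]mulrC|exact: integrable_lor].
Qed.

End laplace.

(** * Integration on R^n *)

Section cons_measure_integral.
Context (R : realType) (n : nat).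
Local Notation TR := (measurableTypeR R).
Variable m : {sigma_finite_measure set (n.-tuple TR) -> \bar R}.
Let l : {sigma_finite_measure set TR -> \bar R} := @lebesgue_measure R.

Lemma cintegral_cons_measure (f : n.+1.-tuple TR -> R[i]) :
  cmeasurable setT f -> cintegrable (l \x m)%E setT (f \o @cons_pair R n) ->
  cintegrable (cons_measure m) setT f /\
  cintegral (cons_measure m) setT f = cintegral (l \x m)%E setT (f \o @cons_pair R n).
Proof.
have mc : measurable_fun setT (@cons_pair R n) by exact: measurable_cons.
move=> [mf1 mf2] [f1 f2].
have mE (g : n.+1.-tuple TR -> R) : measurable_fun setT g ->
    measurable_fun setT (EFin \o g) by move=> ?; exact/measurable_EFinP.
split; first split.
- apply: (@integrable_pushforward _ _ _ _ _ _ mc (l \x m)%E setT) => //; exact: mE.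
- apply: (@integrable_pushforward _ _ _ _ _ _ mc (l \x m)%E setT) => //; exact: mE.
- apply: complexP; congr fine.
  + by apply: (@integral_pushforward _ _ _ _ _ _ mc (l \x m)%E setT) => //; exact: mE.
  + by apply: (@integral_pushforward _ _ _ _ _ _ mc (l \x m)%E setT) => //; exact: mE.
Qed.

End cons_measure_integral.

Section Rn_products.
Context (R : realType).
Local Notation TR := (measurableTypeR R).
Let l : {sigma_finite_measure set TR -> \bar R} := @lebesgue_measure R.

Lemma cmeasurable_prod n (phi : 'I_n -> TR -> R[i]) :
  (forall i, cmeasurable setT (phi i)) ->
  cmeasurable setT (fun v : n.-tuple TR => \prod_i phi i (tnth v i)).
Proof.
move=> mphi.
have H (r : seq 'I_n) : cmeasurable setT (fun v : n.-tuple TR => \prod_(i <- r) phi i (tnth v i)).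
  elim: r => [|i r IH].
    by under eq_fun do rewrite big_nil; exact: cmeasurable_cst.
  under eq_fun do rewrite big_cons; apply: cmeasurableM => //.
  exact: (cmeasurable_comp (mphi i) (measurable_tnth i)).
exact: H.
Qed.

(** Fubini in the first coordinate, by induction. It reduces both the Gaussian on R^n and the
    majorant of a Schwartz function to dimension one. *)
Lemma cintegral_Rn_prod n (phi : 'I_n -> TR -> R[i]) :
  (forall i, cintegrable l setT (phi i)) ->
  cintegrable (lebesgue_Rn R n) setT (fun v => \prod_i phi i (tnth v i)) /\
  cintegral (lebesgue_Rn R n) setT (fun v => \prod_i phi i (tnth v i)) =
  \prod_i cintegral l setT (phi i).
Proof.
elim: n phi => [|n IH] phi iphi.
  (* In dimension 0 the measure is a Dirac mass and both sides are the empty product 1. *)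
  rewrite big_ord0; under eq_fun do rewrite big_ord0.
  have mc (c : R) : measurable_fun [set: 0.-tuple TR] (fun=> c%:E) by exact: measurable_cst.
  split; last first.
    by apply: complexP; rewrite /= /Rintegral integral_dirac// diracT mul1e.
  split; apply/integrableP; split => //; by rewrite integral_dirac// diracT mul1e /= ltry.
have iphi' i : cintegrable l setT (phi (lift ord0 i)) by exact: iphi.
have [iP IP] := IH _ iphi'.
set P := (fun v : n.-tuple TR => _) in iP IP.
pose f (v : n.+1.-tuple TR) := \prod_i phi i (tnth v i).
have fE x v : f (cons_pair (x, v)) = phi ord0 x * P v.
  by rewrite /f big_ord_recl tnth0; congr (_ * _); apply: eq_bigr => i _; rewrite tnthS.
have mf : cmeasurable setT f by apply: cmeasurable_prod => i; exact: cintegrable_measurable (iphi i).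
have ifc : cintegrable (l \x lebesgue_Rn R n)%E setT (f \o @cons_pair R n).
  apply: (@cintegrable_prod _ _ _ _ _ l (lebesgue_Rn R n) _
    (fun x => normc (phi ord0 x)) (fun v => normc (P v))).
  - by apply: cmeasurable_comp mf _; exact: measurable_cons.
  - by move=> x v; rewrite /= fE Normc.normcM.
  - exact: cintegrable_norm.
  - exact: cintegrable_norm.
have [if_ ef] := cintegral_cons_measure mf ifc; split => //.
rewrite [LHS]ef -(cfubini1 ifc).2 big_ord_recl -IP.
transitivity (cintegral l setT (fun x => cintegral (lebesgue_Rn R n) setT P * phi ord0 x)).
  apply: eq_cintegral => x _ /=.
  under eq_cintegral do rewrite fE.
  by rewrite cintegralZl// mulrC.
by rewrite cintegralZl// mulrC.
Qed.

End Rn_products.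

Section cexp_sum.
Variable R : realType.

Lemma Re_sum I (r : seq I) (f : I -> R[i]) :
  Re (\sum_(i <- r) f i) = \sum_(i <- r) Re (f i).
Proof. by elim/big_ind2 : _ => // a b c e <- <-; rewrite cReD. Qed.

Lemma Im_sum I (r : seq I) (f : I -> R[i]) :
  Im (\sum_(i <- r) f i) = \sum_(i <- r) Im (f i).
Proof. by elim/big_ind2 : _ => // a b c e <- <-; rewrite cImD. Qed.

Lemma cexp_sum I (r : seq I) (f : I -> R[i]) :
  cexp (\sum_(i <- r) f i) = \prod_(i <- r) cexp (f i).
Proof.
elim: r => [|i r IH]; last by rewrite !big_cons cexpD IH.
by rewrite !big_nil -[0]/((0 : R)%:C) cexp_real expR0.
Qed.

End cexp_sum.

Section Rn.
Context (R : realType).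
Local Notation TR := (measurableTypeR R).
Local Notation mu := (@lebesgue_measure R).
Local Notation lor y := (oneDsqr y)^-1.
Let l : {sigma_finite_measure set TR -> \bar R} := @lebesgue_measure R.

(** Passes from tuples, which carry the measure, to row vectors, which carry the norm; convertible
    to the argument used in [integral_Rn]. *)
Definition row_of n (v : n.-tuple TR) : 'rV[R]_n := \row_i tnth v i.

Lemma dotrv_row_of n (x : 'rV[R]_n) v : dotrv x (row_of v) = \sum_i x 0 i * tnth v i.
Proof. by apply: eq_bigr => i _; rewrite mxE. Qed.

Lemma enorm_sqr n (x : 'rV[R]_n) : enorm x ^+ 2 = \sum_i x 0 i ^+ 2.
Proof.
rewrite /enorm sqr_sqrtr; first by apply: eq_bigr => i _; rewrite expr2.
by apply: sumr_ge0 => i _; rewrite -expr2 sqr_ge0.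
Qed.

Lemma enorm_sqr_row_of n (v : n.-tuple TR) :
  enorm (row_of v) ^+ 2 = \sum_i tnth v i ^+ 2.
Proof. by rewrite enorm_sqr; apply: eq_bigr => i _; rewrite mxE. Qed.

Definition character n (x : 'rV[R]_n) (v : n.-tuple TR) : R[i] :=
  cexp (- (2 * pi)%:C * 'i * (dotrv x (row_of v))%:C).

Lemma heat_fourier n (x : 'rV[R]_n) tau : 0 < tau ->
  let E := fun v : n.-tuple TR => character x v *
    (expR (- (tau * (2 * pi * enorm (row_of v)) ^+ 2)))%:C in
  cintegrable (lebesgue_Rn R n) setT E /\
  cintegral (lebesgue_Rn R n) setT E = (heat_kernel x tau)%:C.
Proof.
move=> tau0 E; have pi0 := @pi_gt0 R.
have pi0' : pi != 0 :> R by rewrite gt_eqF.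
have tau0' : tau != 0 by rewrite gt_eqF.
(* Chosen so that d y^2 = tau (2 pi y)^2: the integrand factors into one-dimensional Gaussians with
   frequencies - 2 pi x_i. *)
pose d : R := 4 * pi ^+ 2 * tau.
have d0 : 0 < d by rewrite !mulr_gt0// exprn_gt0.
pose w i := - (2 * pi * x 0 i).
pose phi (i : 'I_n) (y : TR) : R[i] :=
  (expR (- (d * y ^+ 2)))%:C * cexp (0 +i* (w i * y)).
have EE v : E v = \prod_i phi i (tnth v i).
  rewrite /E /character -cexp_real -cexpD.
  under eq_bigr do rewrite /phi -cexp_real -cexpD.
  rewrite -cexp_sum; congr cexp; apply: complexP.
    rewrite Re_sum !(cReD, cReM, cImM, cReN, cImN)/=.
    have -> : tau * (2 * pi * enorm (row_of v)) ^+ 2 =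
        \sum_i tau * ((2 * pi) ^+ 2 * tnth v i ^+ 2).
      by rewrite exprMn enorm_sqr_row_of !mulr_sumr.
    rewrite [RHS](eq_bigr (fun i => - (tau * ((2 * pi) ^+ 2 * tnth v i ^+ 2)))).
      by rewrite sumrN; ring.
    by move=> i _; rewrite /d; ring.
  rewrite Im_sum !(cImD, cReM, cImM, cReN, cImN)/=.
  rewrite dotrv_row_of [RHS](eq_bigr (fun i => - (2 * pi) * (x 0 i * tnth v i))).
    by rewrite -mulr_sumr; ring.
  by move=> i _; rewrite /w; ring.
have G i := gauss_fourier (w i) d0.
have [iP IP] := cintegral_Rn_prod (fun i => (G i).1).
split; first by apply: eq_cintegrable iP => // v _; rewrite EE.
transitivity (cintegral (lebesgue_Rn R n) setT (fun v => \prod_i phi i (tnth v i))).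
  by apply: eq_cintegral => v _; rewrite EE.
rewrite IP; under eq_bigr do rewrite (G _).2.
rewrite -rmorph_prod; congr (_%:C); rewrite big_split/= prodr_const card_ord.
rewrite -expR_sum /heat_kernel; congr (_ * expR _).
- have F (p q : R) : p != 0 -> q != 0 -> p / (4 * p ^+ 2 * q) = (4 * p * q)^-1.
    by move=> p0 q0; field; rewrite p0 q0.
  have -> : pi / d = (4 * pi * tau)^-1 by exact: F.
  have a0 : 0 <= 4 * pi * tau by rewrite !mulr_ge0 ?(ltW pi0) ?(ltW tau0).
  rewrite -powR12_sqrt ?invr_ge0// -powR_mulrn ?powR_ge0// -powR_inv1// -!powRrM.
  by congr powR; field.
- have F (p q y : R) : p != 0 -> q != 0 ->
      (- (2 * p * y)) ^+ 2 / (4 * (4 * p ^+ 2 * q)) = y ^+ 2 / (4 * q).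
    by move=> p0 q0; field; rewrite p0 q0.
  rewrite sumrN; congr (- _); rewrite enorm_sqr mulr_suml; apply: eq_bigr => i _.
  exact: F.
Qed.

Lemma heat_integral n tau : 0 < tau ->
  (lebesgue_Rn R n).-integrable setT
    (fun v => (expR (- (tau * (2 * pi * enorm (row_of v)) ^+ 2)))%:E) /\
  \int[lebesgue_Rn R n]_v expR (- (tau * (2 * pi * enorm (row_of v)) ^+ 2)) =
  (4 * pi * tau) `^ (- (n%:R / 2)).
Proof.
move=> tau0; have [iE] := heat_fourier (0 : 'rV[R]_n) tau0.
have dot0 v : dotrv (0 : 'rV[R]_n) (row_of v) = 0.
  by rewrite dotrv_row_of big1// => i _; rewrite mxE mul0r.
have EE (v : n.-tuple TR) : character 0 v *
    (expR (- (tau * (2 * pi * enorm (row_of v)) ^+ 2)))%:C =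
    (expR (- (tau * (2 * pi * enorm (row_of v)) ^+ 2)))%:C.
  by rewrite /character dot0 mulr0 -[0]/((0 : R)%:C) cexp_real expR0 mul1r.
move=> /(congr1 (@complex.Re R)) /= IE; split.
  by case: iE => + _; apply: eq_integrable => // v _; rewrite EE.
transitivity (\int[lebesgue_Rn R n]_v Re (character 0 v *
    (expR (- (tau * (2 * pi * enorm (row_of v)) ^+ 2)))%:C)).
  by apply: eq_Rintegral => v _; rewrite EE.
rewrite IE /heat_kernel (_ : enorm 0 = 0) ?expr0n ?mul0r ?oppr0 ?expR0 ?mulr1//.
apply/eqP; rewrite -sqrf_eq0 enorm_sqr big1// => i _.
by rewrite mxE expr0n.
Qed.

(** The origin lies in the hyperplane where the first coordinate vanishes, a null set. For n = 0 the
    only point would be an atom. *)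
Lemma ae_enorm_neq0 n : (1 <= n)%N ->
  {ae lebesgue_Rn R n, forall v, enorm (row_of v) != 0}.
Proof.
case: n => // n _.
have mc : measurable_fun setT (@cons_pair R n) by exact: measurable_cons.
have mN : measurable [set v : n.+1.-tuple TR | tnth v ord0 = 0].
  rewrite -[X in measurable X]setTI.
  exact: (@measurable_tnth _ TR n.+1 ord0 measurableT [set 0] (measurable_set1 0)).
exists [set v | tnth v ord0 = 0]; split => //.
- have -> : lebesgue_Rn R n.+1 [set v | tnth v ord0 = 0] =
      (l \x lebesgue_Rn R n)%E ([set 0] `*` setT).
    rewrite /= /cons_measure /pushforward; congr (_ _).
    apply/seteqP; split => -[x v] /=; first by rewrite tnth0.
    by move=> [+ _]; rewrite tnth0.
  by rewrite product_measure1E//= [X in (X * _)%E](lebesgue_measure_set1 0) mul0e.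
- move=> v /= /negP; rewrite negbK => /eqP v0.
  have : enorm (row_of v) ^+ 2 = 0 by rewrite v0 expr0n.
  rewrite enorm_sqr_row_of => /eqP; rewrite psumr_eq0; last by move=> i _; exact: sqr_ge0.
  by move=> /allP/(_ ord0 (mem_index_enum _))/=; rewrite sqrf_eq0 => /eqP.
Qed.

(** Measurable sets of tuples are generated by the coordinates, while continuity refers to the
    topology of row vectors. Writing {f > a} as a countable union of rational boxes links the
    two. *)
Lemma continuous_measurable_row_of n (f : 'rV[R]_n -> R) :
  continuous f -> measurable_fun setT (fun v : n.-tuple TR => f (row_of v)).
Proof.
move=> cf mT; apply: (measurability _ (RGenOInfty.measurableE R)) => //.
move=> /= _ [_ [a ->] <-]; rewrite preimage_itvoy setTI.
pose box (z : {ffun 'I_n -> rat} * nat) : set (n.-tuple TR) :=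
  [set v | forall i, `|ratr (z.1 i) - tnth v i| < z.2.+1%:R^-1].
pose good z := forall v, box z v -> a < f (row_of v).
(* The union runs over all rational centres and radii, a countable type; boxes not contained in {f >
   a} are replaced by the empty set. *)
rewrite [X in measurable X](_ : _ =
    \bigcup_z (if pselect (good z) then box z else set0)); last first.
  apply/seteqP; split => [v|v [z _]] /=; last first.
    by case: pselect => // gz; exact: gz.
  move=> av; have /nbhs_ballP[e /= e0 eA] : \forall x \near row_of v, a < f x.
    exact: (cf (row_of v) _ (lt_nbhsr av)).
  (* A box of radius 1 / (k + 1) containing v stays within 2 / (k + 1) < e of v. *)
  pose k := Num.truncn (2 / e).
  have ke : 2 * k.+1%:R^-1 < e.
    by rewrite ltr_pdivrMr// mulrC -ltr_pdivrMr// truncnS_gt.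
  have k0 : 0 < k.+1%:R^-1 :> R by rewrite invr_gt0.
  have /choice[q Hq] : forall i : 'I_n, exists q : rat, `|ratr q - tnth v i| < k.+1%:R^-1.
    move=> i; have : tnth v i - k.+1%:R^-1 < tnth v i + k.+1%:R^-1 :> R.
      by rewrite ltrBlDr -addrA ltrDl addr_gt0.
    by move=> /rat_in_itvoo[q]; rewrite in_itv/= => qv; exists q; rewrite ltr_distl.
  exists ([ffun i => q i], k) => //=; case: pselect => [_ i|ngz]; first by rewrite ffunE.
  exfalso; apply: ngz => u bu; apply: eA; split => // i j; rewrite !mxE /ball/=.
  have := bu j; rewrite /= ffunE => uj; have vj := Hq j.
  rewrite (le_lt_trans (ler_distD (ratr (q j)) _ _))// (le_lt_trans _ ke)//.
  by rewrite mulrDl mul1r lerD// ltW// distrC.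
apply: countable_bigcupT_measurable; first exact: countableP.
move=> z; case: pselect => //= gz.
have -> : box z = \bigcap_(i in [set: 'I_n]) [set v | `|ratr (z.1 i) - tnth v i| < z.2.+1%:R^-1].
  by apply/seteqP; split => v /= H i; [move=> _; exact: H|exact: H].
apply: fin_bigcap_measurable; first exact: finite_finset.
move=> i _; rewrite -[X in measurable X]setTI.
have m : measurable_fun setT (fun v : n.-tuple TR => `|ratr (z.1 i) - tnth v i : R|).
  apply: measurableT_comp => //; apply: measurable_funB => //.
  exact: measurable_tnth.
have := m measurableT `]-oo, z.2.+1%:R^-1[%classic (measurable_itv _).
by rewrite preimage_itvNyo.
Qed.

End Rn.

(** * Subordination *)

Section schwartz_integrable.
Context (R : realType) (n : nat).
Local Notation TR := (measurableTypeR R).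
Local Notation lor y := (oneDsqr y)^-1.

Lemma measurable_sum_tnth (f : 'I_n -> TR -> R) :
  (forall i, measurable_fun setT (f i)) ->
  measurable_fun setT (fun v : n.-tuple TR => \sum_i f i (tnth v i)).
Proof.
move=> mf.
have H (r : seq 'I_n) :
    measurable_fun setT (fun v : n.-tuple TR => \sum_(i <- r) f i (tnth v i)).
  elim: r => [|i r IH].
    by under eq_fun do rewrite big_nil; exact: measurable_cst.
  under eq_fun do rewrite big_cons; apply: measurable_funD => //.
  exact: (measurableT_comp (mf i) (measurable_tnth i)).
exact: H.
Qed.

Lemma measurable_enorm_sqr (x : 'rV[R]_n) :
  measurable_fun setT (fun v : n.-tuple TR => enorm (x - row_of v) ^+ 2).
Proof.
have E v : enorm (x - row_of v) ^+ 2 = \sum_i (x 0 i - tnth v i) ^+ 2.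
  by rewrite enorm_sqr; apply: eq_bigr => i _; rewrite !mxE.
under eq_fun do rewrite E.
apply: (measurable_sum_tnth (f := fun i y => (x 0 i - y) ^+ 2)) => i.
by apply: measurable_funX; exact: measurable_funB.
Qed.

Lemma measurable_enorm_sqr0 :
  measurable_fun setT (fun v : n.-tuple TR => enorm (row_of v) ^+ 2).
Proof.
under eq_fun do rewrite enorm_sqr_row_of.
by apply: (measurable_sum_tnth (f := fun i y => y ^+ 2)) => i; exact: measurable_funX.
Qed.

Lemma cmeasurable_character (x : 'rV[R]_n) : cmeasurable setT (character x).
Proof.
apply: cmeasurable_cexp; apply: cmeasurableM; first exact: cmeasurable_cst.
apply: cmeasurable_real; under eq_fun do rewrite dotrv_row_of.
by apply: (measurable_sum_tnth (f := fun i y => x 0 i * y)) => i; exact: measurable_funM.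
Qed.

Lemma normc_character (x : 'rV[R]_n) v : normc (character x v) = 1.
Proof.
rewrite normc_cexp !cReM !cImM /= !(mulr0, mul0r, subr0, add0r, oppr0, addr0, subrr).
by rewrite expR0.
Qed.

(** Decay of order 2 n gives |u| <= M (1 + |x|^2)^-n, and (1 + |x|^2)^n dominates the product of the
    1 + x_i^2. *)
Lemma schwartz_cintegrable (u : 'rV[R]_n -> R[i]) : schwartz u ->
  cintegrable (lebesgue_Rn R n) setT (fun v => u (row_of v)).
Proof.
move=> [/(_ [::])[/= c1 c2 _] /(_ (2 * n)%N)[M HM]].
have phi_i (i : 'I_n) : cintegrable (@lebesgue_measure R) setT (fun y => (lor y)%:C).
  apply: (line_cintegrable (K := 1)) => [|y].
    by split => /=; [exact: continuous_oneDsqrV|move=> y; exact: cvg_cst].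
  by rewrite normc_real mul1r ger0_norm// ltW// lor_gt0.
have [[ir _] _] := cintegral_Rn_prod phi_i.
apply: (@cintegrable_le _ _ _ _ setT _ (fun v : n.-tuple TR => M * \prod_i lor (tnth v i))) => //.
- split.
  + exact: (continuous_measurable_row_of (f := fun y => Re (u y))).
  + exact: (continuous_measurable_row_of (f := fun y => Im (u y))).
- move=> v _; have := HM [::] (row_of v) (leq0n _); rewrite /=.
  have a1 : 0 < 1 + enorm (row_of v) ^+ 2 by rewrite ltr_wpDr ?sqr_ge0.
  rewrite natrM mulrAC divff// mul1r powR_mulrn ?(ltW a1)// => Hv.
  have M0 : 0 <= M.
    by rewrite (le_trans _ Hv)// mulr_ge0 ?normc_ge0// exprn_ge0// ltW.
  have an : 0 < (1 + enorm (row_of v) ^+ 2) ^+ n by rewrite exprn_gt0.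
  apply: (@le_trans _ _ (M * ((1 + enorm (row_of v) ^+ 2) ^+ n)^-1)).
    by rewrite ler_pdivlMr// mulrC.
  rewrite ler_wpM2l// prodfV lef_pV2 ?posrE//; last first.
    by apply: prodr_gt0 => i _; rewrite -invr_gt0 lor_gt0.
  rewrite -[X in _ ^+ X](card_ord n) -prodr_const; apply: ler_prod => i _.
  rewrite (le_trans ler01 (oneDsqr_ge1 _))/= lerD2l enorm_sqr_row_of (bigD1 i)//=.
  by rewrite lerDl sumr_ge0// => j _; exact: sqr_ge0.
- have ir' : (lebesgue_Rn R n).-integrable setT
      (EFin \o (fun v : n.-tuple TR => \prod_i lor (tnth v i))).
    by apply: eq_integrable ir => // v _; rewrite -rmorph_prod.
  exact: (integrableZl measurableT M ir').
Qed.

End schwartz_integrable.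

(** * The two subordination identities *)

Section subordination.
Context (R : realType) (n : nat) (s t eps : R).
Hypotheses (n1 : (1 <= n)%N) (s0 : 0 < s) (s1 : s < 1) (t0 : 0 < t) (eps0 : 0 < eps).
Local Notation TR := (measurableTypeR R).
Local Notation mu := (@lebesgue_measure R).
Local Notation B := (bochner_subordinator eps s t).
Let l : {sigma_finite_measure set TR -> \bar R} := @lebesgue_measure R.
Let L := lebesgue_Rn R n.

(** Differs from B at most at tau = 0, where the Gaussian in xi degenerates to 1 and is not
    integrable. With the cut, integrating out the space variable gives the right value for every
    tau. *)
Let B' (tau : TR) : R[i] := if 0 < tau then B tau else 0.

Let mB' : cmeasurable setT B'.
Proof.
have -> : B' = fun tau => (\1_(`]0%R, +oo[%classic) tau : R)%:C * B tau.
  apply/funext => tau; rewrite /B' indicE; case: ifPn => tau0.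
    by rewrite mem_set ?mul1r//= in_itv/= tau0.
  by rewrite memNset ?mul0r//= in_itv/= andbT; exact/negP.
apply: cmeasurableM; last exact: measurable_bochner.
by apply: cmeasurable_real; exact: measurable_indic.
Qed.

Lemma bochner_lt0 tau : tau < 0 -> B tau = 0.
Proof. by move=> tau0; rewrite /bochner_subordinator leNgt tau0. Qed.

Let laplaceB' lam : 0 < lam ->
  cintegral l setT (fun tau : TR => (expR (- (lam * tau)))%:C * B' tau) =
  (expR (- (t * lam `^ s)))%:C.
Proof.
move=> lam0; rewrite -(bochner_laplace s0 s1 t0 eps0 lam0).
have me : cmeasurable setT (fun tau : TR => (expR (- (lam * tau)))%:C).
  apply: cmeasurable_real; apply: measurableT_comp => //; apply: measurableT_comp => //.
apply: ae_eq_cintegral => //; try (apply: cmeasurableM => //; exact: measurable_bochner).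
exists [set 0]; split => //.
- exact: lebesgue_measure_set1.
- move=> tau /= H; apply: contrapT => tau0; apply: H => _; rewrite /B'.
  case: ltgtP => // [h|h]; first by rewrite bochner_lt0.
  by exfalso; apply: tau0.
Qed.

Let n20 : 2^-1 <= n%:R / 2 :> R.
Proof. by rewrite ler_pdivlMr// mulVf// ler1n. Qed.

Let n2_neq0 : - (n%:R / 2) != 0 :> R.
Proof. by rewrite oppr_eq0 gt_eqF// (lt_le_trans _ n20). Qed.

(** A default value: [powR] sends base 0 to 0 when the exponent is nonzero, which n >= 1 ensures. *)
Lemma heat_kernel0 (x : 'rV[R]_n) : heat_kernel x 0 = 0.
Proof. by rewrite /heat_kernel mulr0 powR0// mul0r. Qed.

Lemma heat_kernel_ge0 (x : 'rV[R]_n) tau : 0 <= heat_kernel x tau.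
Proof. by rewrite mulr_ge0 ?powR_ge0 ?expR_ge0. Qed.

Lemma heat_kernel_le (x : 'rV[R]_n) tau : 0 < tau ->
  heat_kernel x tau <= (4 * pi * tau) `^ (- (n%:R / 2)).
Proof.
move=> tau0; rewrite ler_piMr ?powR_ge0// -expR0 ler_expR oppr_le0.
by rewrite divr_ge0 ?sqr_ge0// mulr_ge0// ltW.
Qed.

Let B'heat (x : 'rV[R]_n) tau : B' tau * (heat_kernel x tau)%:C = B tau * (heat_kernel x tau)%:C.
Proof.
rewrite /B'; case: ltgtP => // [h|<-]; first by rewrite bochner_lt0// !mul0r.
by rewrite heat_kernel0 !mulr0.
Qed.

(** The weight (4 pi tau)^(- n / 2) is both the mass of the Gaussian in xi and an upper bound for
    the heat kernel, so this majorant serves both claims. *)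
Let weight_integrable :
  l.-integrable setT (EFin \o (fun tau : TR => normc (B' tau) * (4 * pi * tau) `^ (- (n%:R / 2)))).
Proof.
have [K [K0 HK]] := bochner_bound s0 s1 t0 eps0 n20.
have pi0 := @pi_gt0 R.
set w := fun tau : TR => normc (B' tau) * _.
have mw : measurable_fun setT w.
  apply: measurable_funM; first exact: measurable_normc.
  have m : measurable_fun setT (fun tau : TR => 4 * pi * tau) by exact: measurable_funM.
  exact: (measurableT_comp (@measurable_powR R (- (n%:R / 2))) m).
have -> : EFin \o w = (EFin \o w) \_ `]0%R, +oo[%classic.
  apply/funext => tau; rewrite patchE; case: ifPn => //.
  rewrite notin_setE/= in_itv/= andbT => /negP tau0.
  by rewrite /w /B' (negbTE tau0) Normc.normc0 mul0r.
pose c := K * (4 * pi) `^ (- (n%:R / 2)).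
have mI : measurable (`]0%R, +oo[%classic : set TR) by exact: measurable_itv.
apply: (integrable_mkcond _ mI).1.
have ic : l.-integrable `]0%R, +oo[%classic
    (fun tau => (c * (1 + tau) `^ (- (3 / 2)))%:E).
  exact: (integrableZl mI c (integrable_powRN32 R)).
apply: (le_integrable mI _ _ ic) => //.
  by apply/measurable_EFinP; exact: measurable_funTS.
move=> tau /=; rewrite in_itv/= andbT => tau0; rewrite lee_fin.
have c0 : 0 <= c by rewrite mulr_ge0 ?powR_ge0.
rewrite !ger0_norm ?mulr_ge0 ?powR_ge0 ?normc_ge0// /w /B' tau0.
rewrite powRM ?mulr_ge0 ?(ltW pi0) ?(ltW tau0)//.
have {}HK := HK tau tau0.
apply: (le_trans (ler_wpM2r _ HK)); first by rewrite mulr_ge0 ?powR_ge0.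
have e : tau `^ (n%:R / 2) * tau `^ (- (n%:R / 2)) = 1.
  by rewrite powRN divff// gt_eqF// powR_gt0.
rewrite le_eqVlt; apply/orP; left; apply/eqP.
transitivity (c * (1 + tau) `^ (- (3 / 2)) * (tau `^ (n%:R / 2) * tau `^ (- (n%:R / 2)))).
  by rewrite /c; ring.
by rewrite e mulr1.
Qed.

Let cintegral0 d (T : measurableType d) (m : {measure set T -> \bar R}) :
  cintegral m setT (fun=> 0 : R[i]) = 0.
Proof. by apply: complexP; rewrite /= /Rintegral integral0. Qed.

Lemma heat_semigroup0 (u : 'rV[R]_n -> R[i]) x : heat_semigroup 0 u x = 0.
Proof.
rewrite /heat_semigroup /integral_Rn.
by under eq_cintegral do rewrite heat_kernel0 mul0r; rewrite cintegral0.
Qed.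

Lemma frac_heat_kernel_subordination (x : 'rV[R]_n) :
  let F := fun tau : TR => B tau * (heat_kernel x tau)%:C in
  cintegrable l setT F /\ frac_heat_kernel s x t = cintegral l setT F.
Proof.
move=> F; have pi0 := @pi_gt0 R.
pose q (v : n.-tuple TR) := (2 * pi * enorm (row_of v)) ^+ 2.
have mq : measurable_fun setT q.
  rewrite /q; under eq_fun do rewrite exprMn.
  by apply: measurable_funM => //; exact: measurable_enorm_sqr0.
pose G (z : TR * n.-tuple TR) : R[i] :=
  B' z.1 * (character x z.2 * (expR (- (z.1 * q z.2)))%:C).
have me : measurable_fun setT (fun z : TR * n.-tuple TR => expR (- (z.1 * q z.2))).
  apply: measurableT_comp => //; apply: measurableT_comp => //.
  apply: measurable_funM; first exact: measurable_fst.
  exact: (measurableT_comp mq measurable_snd).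
have mG : cmeasurable setT G.
  apply: cmeasurableM; first exact: (cmeasurable_comp mB' measurable_fst).
  apply: cmeasurableM; first exact: (cmeasurable_comp (cmeasurable_character x) measurable_snd).
  exact: cmeasurable_real.
have iG : cintegrable (l \x L)%E setT G.
  apply: (@cintegrable_le _ _ _ _ setT G (fun z => normc (B' z.1) * expR (- (z.1 * q z.2)))) => //.
    move=> z _; rewrite /G Normc.normcM [X in _ * X](_ : _ = expR (- (z.1 * q z.2)))//.
    by rewrite Normc.normcM normc_character mul1r normc_real ger0_norm// expR_ge0.
  (* By Tonelli, integrating |G| over xi first yields exactly the weight of [weight_integrable]. *)
  apply/(integrable12ltyP l L).
    apply/measurable_EFinP; apply: measurable_funM => //.
    exact: (measurableT_comp (measurable_normc mB') measurable_fst).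
  have [_] := integrableP _ _ _ weight_integrable.
  congr (_ < _)%E; apply: eq_integral => tau _ /=.
  have [tau0|tau0] := ltP 0 tau; last first.
    rewrite /B' ltNge tau0/= -[Num.sqrt _]/(normc 0) Normc.normc0 mul0r normr0.
    by under eq_integral do rewrite mul0r normr0; rewrite integral0.
  have [ie Ie] := heat_integral n tau0.
  under eq_integral do rewrite normrM EFinM [X in (_ * X%:E)%E]ger0_norm ?expR_ge0//.
  rewrite integralZl// normrM EFinM; congr (_ * _)%E.
  rewrite -Ie /Rintegral ger0_norm ?fine_ge0 ?integral_ge0//.
    by rewrite fineK// integrable_fin_num.
have FG tau : F tau = cintegral L setT (fun v => G (tau, v)).
  rewrite /F -B'heat /G /=; have [tau0|tau0] := ltP 0 tau.
    have [ih Ih] := heat_fourier x tau0.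
    by rewrite cintegralZl// Ih.
  rewrite /B' ltNge tau0 /= mul0r; under eq_cintegral do rewrite mul0r.
  by rewrite cintegral0.
have [iF eF] := cfubini1 iG; have [iF2 eF2] := cfubini2 iG.
split; first by apply: eq_cintegrable iF => // tau _; rewrite FG.
transitivity (cintegral l setT (fun tau => cintegral L setT (fun v => G (tau, v)))); last first.
  by apply: eq_cintegral => tau _; rewrite FG.
rewrite eF -eF2; apply: ae_eq_cintegral => //.
- apply: cmeasurableM; first exact: (cmeasurable_character x).
  apply: cmeasurable_real; apply: measurableT_comp => //; apply: measurable_funM => //.
  have mqs := measurableT_comp (@measurable_powR R s) mq.
  apply: eq_measurable_fun mqs => v _; rewrite /= /q.
  by rewrite powRrM powR_mulrn// mulr_ge0 ?sqrtr_ge0// mulr_ge0// ltW.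
- exact: cintegrable_measurable iF2.
(* Away from xi = 0 the value q v is positive, as the Laplace formula requires. *)
- apply: filterS (ae_enorm_neq0 R n1) => v v0 _.
  have e0 : 0 < enorm (row_of v) by rewrite lt_neqAle eq_sym v0 sqrtr_ge0.
  have q0 : 0 < q v by rewrite exprn_gt0// !mulr_gt0.
  transitivity (cintegral l setT (fun tau => character x v * ((expR (- (q v * tau)))%:C * B' tau))).
    rewrite cintegralZl ?laplaceB'//.
      rewrite /character /row_of; congr (_ * (expR _)%:C).
      by rewrite mulNr powRrM powR_mulrn// mulr_ge0 ?sqrtr_ge0// mulr_ge0// ltW.
    have i := bochner_laplace_cintegrable s0 s1 t0 eps0 q0.
    apply: (cintegrable_le _ _ _ (cintegrable_norm _ i)) => //.
      apply: cmeasurableM => //; apply: cmeasurable_real.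
      by apply: measurableT_comp => //; apply: measurableT_comp.
    move=> tau _; rewrite !Normc.normcM ler_wpM2l ?normc_ge0// /B'.
    by case: ifPn => // _; rewrite Normc.normc0 normc_ge0.
  by apply: eq_cintegral => tau _; rewrite /G /= [q v * tau]mulrC; ring.
Qed.

Lemma frac_heat_semigroup_subordination (u : 'rV[R]_n -> R[i]) (x : 'rV[R]_n) :
  schwartz u ->
  let F := fun tau : TR => B tau * heat_semigroup tau u x in
  cintegrable l setT F /\ frac_heat_semigroup s t u x = cintegral l setT F.
Proof.
move=> /schwartz_cintegrable iu F; have pi0 := @pi_gt0 R.
have mu_ := cintegrable_measurable iu.
(* The heat kernel with the quotient by 4 tau written as a [powR], so that joint measurability
   follows from [measurable_powR]. The two agree for tau > 0, and B' vanishes elsewhere. *)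
pose h tau (v : n.-tuple TR) : R := (4 * pi * tau) `^ (- (n%:R / 2)) *
  expR (- (enorm (x - row_of v) ^+ 2 * (4 * tau) `^ (- 1))).
have hE tau v : 0 < tau -> heat_kernel (x - row_of v) tau = h tau v.
  by move=> tau0; rewrite /h powR_inv1// mulr_ge0// ltW.
have mpow c a : measurable_fun setT (fun tau : TR => (c * tau) `^ a).
  have m : measurable_fun setT (fun tau : TR => c * tau) by exact: measurable_funM.
  exact: (measurableT_comp (@measurable_powR R a) m).
have mh : measurable_fun setT (fun z : TR * n.-tuple TR => h z.1 z.2).
  apply: measurable_funM; first exact: (measurableT_comp (mpow (4 * pi) _) measurable_fst).
  apply: measurableT_comp => //; apply: measurableT_comp => //.
  apply: measurable_funM; first exact: (measurableT_comp (measurable_enorm_sqr x) measurable_snd).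
  exact: (measurableT_comp (mpow 4 _) measurable_fst).
pose G (z : TR * n.-tuple TR) : R[i] :=
  B' z.1 * ((heat_kernel (x - row_of z.2) z.1)%:C * u (row_of z.2)).
have GE : G = fun z => B' z.1 * ((h z.1 z.2)%:C * u (row_of z.2)).
  apply/funext => -[tau v]; rewrite /G /=; have [tau0|tau0] := ltP 0 tau.
    by rewrite hE.
  by rewrite /B' ltNge tau0 /= !mul0r.
have mG : cmeasurable setT G.
  rewrite GE; apply: cmeasurableM; first exact: (cmeasurable_comp mB' measurable_fst).
  apply: cmeasurableM; first exact: cmeasurable_real.
  exact: (cmeasurable_comp mu_ measurable_snd).
have iG : cintegrable (l \x L)%E setT G.
  apply: (cintegrable_prod mG _ weight_integrable (cintegrable_norm measurableT iu)) => tau v.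
  have -> : normc (G (tau, v)) =
      normc (B' tau) * (heat_kernel (x - row_of v) tau * normc (u (row_of v))).
    rewrite /G Normc.normcM; congr (_ * _).
    by rewrite Normc.normcM normc_real ger0_norm// heat_kernel_ge0.
  have [tau0|tau0] := ltP 0 tau; last first.
    by rewrite /B' ltNge tau0 [normc _](@Normc.normc0 R) !mul0r.
  rewrite -[leRHS]mulrA ler_wpM2l ?normc_ge0// ler_wpM2r ?normc_ge0//.
  exact: heat_kernel_le.
have FG tau : F tau = cintegral L setT (fun v => G (tau, v)).
  rewrite /F /G /=; have [tau0|tau0|<-] := ltgtP 0 tau.
  - rewrite /B' tau0 cintegralZl//.
    apply: (@cintegrable_le _ _ _ _ setT _ (fun v => (4 * pi * tau) `^ (- (n%:R / 2)) * normc (u (row_of v)))) => //.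
    + apply: cmeasurableM => //; apply: cmeasurable_real.
      under eq_fun do rewrite hE//.
      exact: (measurable_fun_pair2 tau mh).
    + move=> v _; rewrite Normc.normcM normc_real ler_wpM2r ?normc_ge0//.
      by rewrite ger0_norm ?heat_kernel_ge0// heat_kernel_le.
    + exact: (integrableZl measurableT _ (cintegrable_norm measurableT iu)).
  - rewrite bochner_lt0// mul0r /B' ltNge ltW//=.
    by under eq_cintegral do rewrite mul0r; rewrite cintegral0.
  - rewrite /B' ltxx; under eq_cintegral do rewrite mul0r.
    by rewrite cintegral0 heat_semigroup0 mulr0.
have [iF eF] := cfubini1 iG; have [_ eF2] := cfubini2 iG.
split; first by apply: eq_cintegrable iF => // tau _; rewrite FG.
transitivity (cintegral l setT (fun tau => cintegral L setT (fun v => G (tau, v)))); last first.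
  by apply: eq_cintegral => tau _; rewrite FG.
rewrite eF -eF2; apply: eq_cintegral => v _.
(* For fixed y the inner integral over tau is the first identity at x - y. *)
have [iK ->] := frac_heat_kernel_subordination (x - row_of v).
rewrite mulrC -cintegralZl//; apply: eq_cintegral => tau _.
by rewrite -B'heat /G /=; ring.
Qed.

End subordination.

Unset Implicit Arguments.
Set Strict Implicit.
Set Printing Implicit Defensive.

(** Integrability is asserted with each identity because [cintegral] is a total function, with a
    value even where the integral diverges. *)
Theorem theorem18p3 (R : realType) (n : nat) (s eps : R) :
  (1 <= n)%N -> 0 < s -> s < 1 -> 0 < eps ->
  (forall (x : 'rV[R]_n) (t : R), 0 < t ->
     let F := fun tau : measurableTypeR R =>
       bochner_subordinator eps s t tau * (heat_kernel x tau)%:C in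
     cintegrable lebesgue_measure `]0%R, +oo[ F /\
     frac_heat_kernel s x t = cintegral lebesgue_measure `]0%R, +oo[ F) /\
  (forall u : 'rV[R]_n -> R[i], schwartz u ->
   forall (x : 'rV[R]_n) (t : R), 0 < t ->
     let F := fun tau : measurableTypeR R =>
       bochner_subordinator eps s t tau * heat_semigroup tau u x in
     cintegrable lebesgue_measure `]0%R, +oo[ F /\
     frac_heat_semigroup s t u x = cintegral lebesgue_measure `]0%R, +oo[ F).
Proof.
move=> n1 s0 s1 eps0.
have mI : measurable (`]0%R, +oo[%classic : set (measurableTypeR R)).
  exact: measurable_itv.
(* Outside ]0, +oo[ either the subordinator vanishes or tau = 0, where the heat kernel and semigroup
   take the value 0; so integrals over the half-line and over the line agree. *)
have bochner0 t tau : ~ `]0%R, +oo[%classic tau ->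
    tau = 0 \/ bochner_subordinator eps s t tau = 0.
  rewrite /= in_itv/= andbT => /negP; rewrite -leNgt le_eqVlt => /predU1P[->|].
    by left.
  by move=> tau0; right; exact: bochner_lt0.
split => [x t t0 F|u su x t t0 F].
- have [iF eF] := frac_heat_kernel_subordination n1 s0 s1 t0 eps0 x.
  have F0 tau : ~ `]0%R, +oo[%classic tau -> F tau = 0.
    by move=> /(bochner0 t)[->|e]; rewrite /F ?heat_kernel0 ?mulr0// e mul0r.
  by split; [exact/(cintegrable_mkcond _ mI F0)|rewrite cintegral_mkcond].
- have [iF eF] := frac_heat_semigroup_subordination n1 s0 s1 t0 eps0 x su.
  have F0 tau : ~ `]0%R, +oo[%classic tau -> F tau = 0.
    move=> /(bochner0 t)[->|e]; last by rewrite /F e mul0r.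
    by rewrite /F heat_semigroup0 ?mulr0.
  by split; [exact/(cintegrable_mkcond _ mI F0)|rewrite cintegral_mkcond].
Qed.
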